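(* Let $d\ge 1$ be an integer and let $S^d$ be the round unit sphere (constant sectional curvature $+1$). Let $\lambda_{k,d}=k(k+d-1)$ and $\mu_{k,d}=\frac{(2k+d-1)(k+d-2)!}{k!\,(d-1)!}$ for $k\ge 1$ (and $\mu_{0,d}=1$), and let $a_{n,d}$ be the heat invariants of $S^d$, defined by the asymptotic expansion $$\sum_{k=0}^{\infty}\mu_{k,d}\,e^{-t\lambda_{k,d}}\sim\sum_{n=0}^{\infty}a_{n,d}\,t^{n-\frac d2},\qquad t\to 0+.$$ Then for every integer $n\ge 1$ and every integer $\omega\ge 2n$, $$a_{n,d}=\sum_{j=1}^{\omega}\frac{2(-1)^n\,\Gamma(\omega+\frac d2+1)}{(\omega-j)!\,(j+n)!\,(2j+d)!}\sum_{k=1}^{j}(-1)^k\binom{2j+d-1}{j-k}\mu_{k,d}\,\lambda_{k,d}^{\,j+n}.$$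
   Context: The Laplace–Beltrami operator $\Delta$ (nonnegative sign convention) on $S^d$ has eigenvalues $\lambda_{k,d}=k(k+d-1)$, $k\ge 0$, with multiplicities $\mu_{k,d}$ as given; the left side of the expansion is the trace of $e^{-t\Delta}$. *)

(* Defs.v *)
From Stdlib Require Import Reals Factorial.
From Coquelicot Require Import Coquelicot.

Open Scope R_scope.

Definition Gamma (x : R) : R :=
  RInt_gen (fun t => Rpower t (x - 1) * exp (- t))
    (at_right 0) (Rbar_locally p_infty).

Definition lambda (k d : nat) : R := INR k * (INR k + INR d - 1).

(* For k >= 1 and d >= 1 none of the natural-number subtractions truncates. *)
Definition mu (k d : nat) : R :=
  match k with
  | O => 1
  | S _ =>
      INR (2 * k + d - 1) * INR (fact (k + d - 2)) /
      (INR (fact k) * INR (fact (d - 1)))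
  end.

(* Trace of exp (- t Delta) on the unit sphere of dimension d. *)
Definition heat_trace (d : nat) (t : R) : R :=
  Series (fun k => mu k d * exp (- t * lambda k d)).

(* Poincare asymptotic expansion as t -> 0+: after the term of index N the
   remainder is o(t^(N - d/2)).  [is_domin F f g] means g = o(f) along F. *)
Definition heat_invariants (d : nat) (a : nat -> R) : Prop :=
  forall N : nat,
    is_domin (at_right 0)
      (fun t : R => Rpower t (INR N - INR d / 2))
      (fun t : R => heat_trace d t -
         sum_n (fun n => a n * Rpower t (INR n - INR d / 2)) N).

(* Main.v *)
Require Import Defs.
From Stdlib Require Import Reals Factorial.
From Coquelicot Require Import Coquelicot.
From Stdlib Require Import Lra Lia Classical.

Open Scope R_scope.

(** Let r be the distance to a fixed point of the sphere.  Since Delta maps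
    (2 sin(r/2))^(2s) to a combination of itself and (2 sin(r/2))^(2s-2), the heat
    flow of this function has at that point an expansion
    c_d(s) t^s (1 + p_1(s) t + p_2(s) t^2 + ...) with p_n a polynomial in s of degree
    at most 2n, characterised by
    (s + n) p_n(s) - s p_n(s - 1) = - s (s + d - 1) p_(n-1)(s).
    At a natural number s = j the function is a combination of the spherical
    harmonics of degree at most j, and p_n(j) is the inner sum of the statement up to
    a factor; at s = - d/2 the power of r cancels the volume element and p_n(- d/2) is
    a_n / a_0.  As n >= 1 makes p_n(0) = 0, the formula is the Lagrange extrapolation
    of p_n from the nodes 0, ..., omega, with omega >= 2n, to - d/2.

    The value at - d/2 is the only analytic point.  With rho = (d - 1)/2 the trace is
    exp(t rho^2) times the sum of mu_k exp(- t x^2) over x = k + rho.  The sums with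
    additional factors x^(2i) satisfy a recursion from d to d + 2, matched by
    q_n(s) = p_n(s) - (s + d) p_(n-1)(s + 1) on the side of the polynomials (after
    removing the factor exp(t rho^2)).  For d = 1 and d = 2 the polynomials are
    explicit in terms of the coefficients of (sinh(y/2)/(y/2))^r, polynomial in r, and
    the sums are evaluated by Euler-Maclaurin summation, whose coefficients are those
    of the same power with r = -1. *)

(** * Finite sums and binomial sums *)

Lemma sum_mult_l (c : R) (f : nat -> R) (N : nat) :
  c * sum_f_R0 f N = sum_f_R0 (fun k => c * f k) N.
Proof.
  induction N as [|N IH]; simpl; [ring|]. rewrite <- IH; ring.
Qed.

Lemma sum_mult_r (c : R) (f : nat -> R) (N : nat) :
  sum_f_R0 f N * c = sum_f_R0 (fun k => f k * c) N.
Proof.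
  induction N as [|N IH]; simpl; [ring|]. rewrite <- IH; ring.
Qed.

Lemma sum_add (f g : nat -> R) (N : nat) :
  sum_f_R0 f N + sum_f_R0 g N = sum_f_R0 (fun k => f k + g k) N.
Proof. symmetry; apply plus_sum. Qed.

Lemma sum_sub (f g : nat -> R) (N : nat) :
  sum_f_R0 f N - sum_f_R0 g N = sum_f_R0 (fun k => f k - g k) N.
Proof. symmetry; apply minus_sum. Qed.

Lemma sum_zero (f : nat -> R) (N : nat) :
  (forall k, (k <= N)%nat -> f k = 0) -> sum_f_R0 f N = 0.
Proof.
  induction N as [|N IH]; intros H; simpl; [auto|].
  rewrite IH by (intros; apply H; lia). rewrite H by lia; ring.
Qed.

Lemma sum_head (f : nat -> R) (N : nat) :
  sum_f_R0 f (S N) = f 0%nat + sum_f_R0 (fun k => f (S k)) N.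
Proof. rewrite decomp_sum by lia; reflexivity. Qed.

Lemma sum_truncate (f : nat -> R) (n m : nat) :
  (n <= m)%nat -> (forall k, (n < k <= m)%nat -> f k = 0) ->
  sum_f_R0 f m = sum_f_R0 f n.
Proof.
  induction m as [|m IH]; intros Hnm H.
  - replace n with 0%nat by lia; reflexivity.
  - destruct (Nat.eq_dec n (S m)) as [->|Hne]; [reflexivity|].
    simpl. rewrite IH by (try lia; intros; apply H; lia).
    rewrite H by lia; ring.
Qed.

Lemma sum_abs_le (f g : nat -> R) (N : nat) :
  (forall k, (k <= N)%nat -> Rabs (f k) <= g k) ->
  Rabs (sum_f_R0 f N) <= sum_f_R0 g N.
Proof.
  intros H. eapply Rle_trans; [apply Rsum_abs|].
  apply sum_Rle; exact H.
Qed.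

Lemma sum_exchange (f : nat -> nat -> R) (N M : nat) :
  sum_f_R0 (fun i => sum_f_R0 (fun j => f i j) M) N =
  sum_f_R0 (fun j => sum_f_R0 (fun i => f i j) N) M.
Proof.
  induction N as [|N IH]; simpl; [reflexivity|].
  rewrite IH, sum_add; reflexivity.
Qed.

Lemma sum_triangle (f : nat -> nat -> R) (N : nat) :
  sum_f_R0 (fun n => sum_f_R0 (fun i => f i (n - i)%nat) n) N =
  sum_f_R0 (fun i => sum_f_R0 (fun m => f i m) (N - i)) N.
Proof.
  induction N as [|N IH]; [reflexivity|].
  rewrite tech5, IH, (tech5 (fun i => f i (S N - i)%nat) N).
  rewrite (tech5 (fun i => sum_f_R0 (fun m => f i m) (S N - i))).
  rewrite Nat.sub_diag, <- Rplus_assoc, sum_add. simpl (sum_f_R0 _ 0). f_equal.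
  apply sum_eq; intros i Hi.
  replace (S N - i)%nat with (S (N - i)) by lia.
  reflexivity.
Qed.

Lemma sum_odd (g : nat -> R) (n : nat) :
  (forall i, g (2 * i)%nat = 0) ->
  sum_f_R0 g (2 * n + 1) = sum_f_R0 (fun i => g (2 * i + 1)%nat) n.
Proof.
  intros H. induction n as [|n IH].
  - specialize (H 0%nat). simpl in H |- *. rewrite H. ring.
  - replace (2 * S n + 1)%nat with (S (S (2 * n + 1))) by lia.
    rewrite !tech5, IH.
    replace (S (2 * n + 1)) with (2 * S n)%nat at 1 by lia.
    rewrite H. replace (S (S (2 * n + 1))) with (2 * S n + 1)%nat by lia. ring.
Qed.

(** Pascal's rule under the summation sign; it drives the inductions on the order of ordinary and of
    central differences. *)
Lemma C_sum_succ (g : nat -> R) (N : nat) :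
  sum_f_R0 (fun j => Binomial.C (S N) j * g j) (S N) =
  sum_f_R0 (fun j => Binomial.C N j * (g j + g (S j))) N.
Proof.
  assert (C0 : forall m, Binomial.C m 0 = 1).
  { intros m; unfold Binomial.C; rewrite Nat.sub_0_r; change (INR (fact 0)) with 1.
    field. apply INR_fact_neq_0. }
  assert (Cn : forall m, Binomial.C m m = 1).
  { intros m; unfold Binomial.C; rewrite Nat.sub_diag; change (INR (fact 0)) with 1.
    field. apply INR_fact_neq_0. }
  destruct N as [|N].
  - simpl. rewrite !C0, !Cn. ring.
  - rewrite sum_head, tech5, C0, Cn.
    transitivity (1 * g 0%nat +
      (sum_f_R0 (fun k => Binomial.C (S N) k * g (S k)) N +
       sum_f_R0 (fun k => Binomial.C (S N) (S k) * g (S k)) N +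
       1 * g (S (S N)))).
    { f_equal. f_equal. rewrite sum_add. apply sum_eq; intros k Hk.
      rewrite <- pascal by lia. ring. }
    transitivity (sum_f_R0 (fun j => Binomial.C (S N) j * g j) (S N) +
      sum_f_R0 (fun j => Binomial.C (S N) j * g (S j)) (S N)).
    { rewrite sum_head, (tech5 _ N), C0, Cn. ring. }
    rewrite sum_add. apply sum_eq; intros; ring.
Qed.

(** * Polynomial functions *)

(* [poly n f]: [f] is a polynomial function of degree less than [n],
   given by its Horner scheme. *)
Fixpoint poly (n : nat) (f : R -> R) : Prop :=
  match n with
  | O => forall x, f x = 0
  | S n' => exists c g, poly n' g /\ forall x, f x = c + x * g x
  end.

Lemma poly_ext (n : nat) : forall f g : R -> R,
  (forall x, g x = f x) -> poly n f -> poly n g.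
Proof.
  destruct n; simpl; intros f g E H.
  - intros; rewrite E; auto.
  - destruct H as (c & h & Hh & Eh). exists c, h. split; auto.
    intros; rewrite E; auto.
Qed.

Lemma poly_plus (n : nat) : forall f g : R -> R,
  poly n f -> poly n g -> poly n (fun x => f x + g x).
Proof.
  induction n as [|n IH]; simpl; intros f g Hf Hg.
  - intros; rewrite Hf, Hg; ring.
  - destruct Hf as (c & f' & Hf & Ef), Hg as (e & g' & Hg & Eg).
    exists (c + e), (fun x => f' x + g' x). split; auto.
    intros; rewrite Ef, Eg; ring.
Qed.

Lemma poly_scal (n : nat) (a : R) : forall f : R -> R,
  poly n f -> poly n (fun x => a * f x).
Proof.
  induction n as [|n IH]; simpl; intros f Hf.
  - intros; rewrite Hf; ring.
  - destruct Hf as (c & f' & Hf & Ef).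
    exists (a * c), (fun x => a * f' x). split; auto.
    intros; rewrite Ef; ring.
Qed.

Lemma poly_minus (n : nat) (f g : R -> R) :
  poly n f -> poly n g -> poly n (fun x => f x - g x).
Proof.
  intros Hf Hg. eapply poly_ext; [|apply poly_plus; [exact Hf|apply (poly_scal _ (-1)), Hg]].
  intros; simpl; ring.
Qed.

Lemma poly_succ (n : nat) : forall f : R -> R, poly n f -> poly (S n) f.
Proof.
  induction n as [|n IH]; intros f Hf.
  - exists 0, (fun _ => 0). split; [intros x; reflexivity|].
    intros; rewrite Hf; ring.
  - destruct Hf as (c & f' & Hf & Ef). exists c, f'. split; auto.
Qed.

Lemma poly_weaken (n m : nat) (f : R -> R) : (n <= m)%nat -> poly n f -> poly m f.
Proof.
  induction 1; intros; auto using poly_succ.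
Qed.

Lemma poly_const (c : R) : poly 1 (fun _ => c).
Proof.
  exists c, (fun _ => 0). split; [intros x; reflexivity|intros; ring].
Qed.

Lemma poly_linear (n : nat) (a b : R) (f : R -> R) :
  poly n f -> poly (S n) (fun x => (a * x + b) * f x).
Proof.
  intros Hf. eapply poly_ext; [|apply poly_plus].
  2: { exists 0, (fun x => a * f x). split; [apply poly_scal, Hf|].
       intros x; reflexivity. }
  2: apply (poly_scal _ b), poly_succ, Hf.
  intros; simpl; ring.
Qed.

Lemma poly_affine (n : nat) (a b : R) : forall f : R -> R,
  poly n f -> poly n (fun x => f (a * x + b)).
Proof.
  induction n as [|n IH]; simpl poly; intros f Hf; [auto|].
  destruct Hf as (c & g & Hg & Ef).
  change (poly (S n) (fun x => f (a * x + b))).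
  eapply poly_ext; [|apply poly_plus; [|apply poly_linear, (IH g Hg)]].
  2: apply (poly_weaken 1); [lia|apply (poly_const c)].
  intros; simpl; apply Ef.
Qed.

Lemma poly_sum (n : nat) (f : nat -> R -> R) (N : nat) :
  (forall k, (k <= N)%nat -> poly n (f k)) ->
  poly n (fun x => sum_f_R0 (fun k => f k x) N).
Proof.
  induction N as [|N IH]; intros H; simpl sum_f_R0.
  - apply (H 0%nat); lia.
  - apply poly_plus; [apply IH; intros; apply H; lia|apply H; lia].
Qed.

(** Division by x - a along the Horner scheme: if f = c + x g and g has quotient g1, then f has
    quotient g + a g1. *)
Lemma poly_factor (n : nat) : forall (f : R -> R) (a : R), poly (S n) f ->
  exists g, poly n g /\ forall x, f x = f a + (x - a) * g x.
Proof.
  induction n as [|n IH]; intros f a (c & g & Hg & Ef).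
  - exists (fun _ => 0). split; [intros x; reflexivity|].
    intros; rewrite !Ef, !Hg; ring.
  - destruct (IH g a Hg) as (g1 & Hg1 & Eg).
    exists (fun x => g x + a * g1 x). split.
    + apply poly_plus; [exact Hg|apply poly_scal, poly_succ, Hg1].
    + intros x. rewrite !Ef, Eg. ring.
Qed.

(** For f = c + x g the difference is g(x + 1) + x (g(x + 1) - g(x)). *)
Lemma poly_diff (n : nat) : forall f : R -> R,
  poly (S n) f -> poly n (fun x => f (x + 1) - f x).
Proof.
  induction n as [|n IH]; intros f (c & g & Hg & Ef).
  - intros x; rewrite !Ef, !Hg; ring.
  - eapply poly_ext; [|apply poly_plus; [apply (poly_affine _ 1 1 _ Hg)|
      apply (poly_linear n 1 0), (IH g Hg)]].
    intros x; simpl. rewrite !Ef. replace (1 * x + 1) with (x + 1) by ring. ring.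
Qed.

(** * Finite differences and Lagrange extrapolation *)

Lemma alternating_sum_succ (N : nat) (f : nat -> R) :
  sum_f_R0 (fun j => (-1) ^ j * Binomial.C (S N) j * f j) (S N) =
  sum_f_R0 (fun j => (-1) ^ j * Binomial.C N j * (f j - f (S j))) N.
Proof.
  transitivity (sum_f_R0 (fun j => Binomial.C (S N) j * ((-1) ^ j * f j)) (S N)).
  { apply sum_eq; intros; ring. }
  rewrite C_sum_succ. apply sum_eq; intros; simpl; ring.
Qed.

Lemma alternating_sum_poly (N : nat) : forall f : R -> R, poly N f ->
  sum_f_R0 (fun j => (-1) ^ j * Binomial.C N j * f (INR j)) N = 0.
Proof.
  induction N as [|N IH]; intros f Hf.
  - simpl; rewrite Hf; ring.
  - rewrite (alternating_sum_succ N (fun j => f (INR j))).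
    transitivity ((-1) * sum_f_R0 (fun j => (-1) ^ j * Binomial.C N j *
         (f (INR j + 1) - f (INR j))) N).
    + rewrite sum_mult_l. apply sum_eq; intros. rewrite S_INR. ring.
    + rewrite (IH _ (poly_diff _ _ Hf)); ring.
Qed.

(** The Pochhammer symbol c (c + 1) ... (c + n - 1). *)
Fixpoint rise (c : R) (n : nat) : R :=
  match n with O => 1 | S n' => rise c n' * (c + INR n') end.

Lemma rise_head (c : R) (n : nat) : rise c (S n) = c * rise (c + 1) n.
Proof.
  induction n as [|n IH].
  - simpl; ring.
  - change (rise c (S n) * (c + INR (S n)) = c * (rise (c + 1) n * (c + 1 + INR n))).
    rewrite IH, S_INR. ring.
Qed.

Lemma rise_neq_0 (c : R) (n : nat) :
  (forall j, (j < n)%nat -> c + INR j <> 0) -> rise c n <> 0.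
Proof.
  induction n as [|n IH]; intros H; simpl; [lra|].
  apply Rmult_integral_contrapositive_currified; [apply IH; intros; apply H; lia|].
  apply H; lia.
Qed.

(** The partial fraction expansion of N! / (c (c + 1) ... (c + N)); the induction subtracts the
    cases c and c + 1. *)
Lemma alternating_sum_inv (N : nat) : forall c : R,
  (forall j, (j <= N)%nat -> c + INR j <> 0) ->
  sum_f_R0 (fun j => (-1) ^ j * Binomial.C N j * / (c + INR j)) N =
  INR (fact N) / rise c (S N).
Proof.
  induction N as [|N IH]; intros c Hc.
  - simpl. unfold Binomial.C; simpl. field. specialize (Hc 0%nat (Nat.le_refl _)).
    simpl in Hc. lra.
  - rewrite (alternating_sum_succ N (fun j => / (c + INR j))).
    assert (Hc1 : forall j, (j <= N)%nat -> c + 1 + INR j <> 0).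
    { intros j Hj. specialize (Hc (S j) ltac:(lia)). rewrite S_INR in Hc. lra. }
    transitivity (INR (fact N) / rise c (S N) - INR (fact N) / rise (c + 1) (S N)).
    + rewrite <- IH, <- IH, sum_sub; [|auto|intros; apply Hc; lia].
      apply sum_eq; intros j Hj. rewrite S_INR.
      replace (c + 1 + INR j) with (c + (INR j + 1)) by ring. ring.
    + assert (H0 : c <> 0).
      { specialize (Hc 0%nat ltac:(lia)). simpl in Hc. lra. }
      assert (HN : c + 1 + INR N <> 0) by (apply Hc1; lia).
      assert (Hr : rise (c + 1) N <> 0) by (apply rise_neq_0; intros; apply Hc1; lia).
      rewrite (rise_head c (S N)), (rise_head c N). simpl rise.
      rewrite fact_simpl, mult_INR, S_INR. field. auto.
Qed.

(** Lagrange's formula for the value at - c from the nodes 0, ..., N. Write P(x) = P(- c) + (x + c)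
    g(x): the constant gives the partial fractions, and g has degree below N, so its alternating sum
    vanishes. *)
Lemma poly_extrapolation (N : nat) (P : R -> R) (c : R) :
  poly (S N) P -> (forall j, (j <= N)%nat -> c + INR j <> 0) ->
  sum_f_R0 (fun j => (-1) ^ j * Binomial.C N j * / (c + INR j) * P (INR j)) N =
  INR (fact N) / rise c (S N) * P (- c).
Proof.
  intros HP Hc. destruct (poly_factor N P (- c) HP) as (g & Hg & EP).
  rewrite <- alternating_sum_inv by exact Hc.
  transitivity (sum_f_R0 (fun j => (-1) ^ j * Binomial.C N j * / (c + INR j) * P (- c)) N
    + sum_f_R0 (fun j => (-1) ^ j * Binomial.C N j * g (INR j)) N).
  - rewrite sum_add. apply sum_eq; intros j Hj. rewrite (EP (INR j)). field. auto.
  - rewrite alternating_sum_poly by exact Hg. rewrite <- sum_mult_r. ring.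
Qed.

(** A point that is not a natural number is reached by extrapolation from nodes where P vanishes;
    the case split keeps x off these nodes. *)
Lemma poly_eq_0 (n : nat) (P : R -> R) :
  poly n P -> (forall j, P (INR j) = 0) -> forall x, P x = 0.
Proof.
  intros HP HZ x. destruct (classic (exists j, x = INR j)) as [[j ->]|Hx]; [auto|].
  assert (Hc : forall j, (j <= n)%nat -> - x + INR j <> 0).
  { intros j _ E. apply Hx. exists j. lra. }
  pose proof (poly_extrapolation n P (- x) (poly_succ _ _ HP) Hc) as E.
  rewrite Ropp_involutive, sum_zero in E by (intros; rewrite HZ; ring).
  symmetry in E. apply Rmult_integral in E as [E|E]; [|exact E].
  exfalso. revert E. unfold Rdiv. apply Rmult_integral_contrapositive_currified.
  - apply INR_fact_neq_0.
  - apply Rinv_neq_0_compat, rise_neq_0. intros; apply Hc; lia.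
Qed.

(** * Powers of sinh(y/2)/(y/2) *)

(** The binomial coefficient with real upper argument r. *)
Fixpoint gbin (r : R) (i : nat) : R :=
  match i with O => 1 | S i' => gbin r i' * (r - INR i') / INR (S i') end.

Lemma gbin_succ (r : R) (i : nat) :
  gbin r (S i) = gbin r i * (r - INR i) / (INR i + 1).
Proof. rewrite <- S_INR. reflexivity. Qed.

Lemma gbin_pascal (r : R) (i : nat) :
  gbin (r + 1) (S i) = gbin r (S i) + gbin r i.
Proof.
  induction i as [|i IH].
  - simpl. field.
  - rewrite (gbin_succ (r + 1)), IH, !gbin_succ, !S_INR.
    pose proof (pos_INR i). field. lra.
Qed.

Lemma gbin_0 (i : nat) : gbin 0 (S i) = 0.
Proof.
  induction i as [|i IH]; [simpl; field|].
  rewrite gbin_succ, IH. unfold Rdiv; ring.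
Qed.

Lemma poly_gbin (i : nat) : poly (S i) (fun r => gbin r i).
Proof.
  induction i as [|i IH]; [apply (poly_const 1)|].
  eapply poly_ext; [|apply (poly_scal _ (/ INR (S i))), (poly_linear _ 1 (- INR i)), IH].
  intros x; cbv beta. rewrite gbin_succ, <- S_INR. unfold Rdiv; ring.
Qed.

Lemma INR_fact_pos (n : nat) : 0 < INR (fact n).
Proof. apply lt_0_INR, lt_O_fact. Qed.

(* [sinhc i] is the coefficient of y^(2i) in the expansion of sinh(y/2)/(y/2). *)
Definition sinhc (i : nat) : R := / (4 ^ i * INR (fact (2 * i + 1))).

(** Coefficients of sinh(y/2)/(y/2) - 1, which has no constant term. *)
Definition sinhc' (i : nat) : R := match i with O => 0 | _ => sinhc i end.

(** The coefficient of y^(2n) in the i-th power of sinh(y/2)/(y/2) - 1. It vanishes for n < i, so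
    the sum in [spow] is the whole binomial series. *)
Fixpoint sinhc_conv (i n : nat) : R :=
  match i with
  | O => match n with O => 1 | _ => 0 end
  | S i' => sum_f_R0 (fun l => sinhc' l * sinhc_conv i' (n - l)) n
  end.

Lemma sinhc_conv_0 (i : nat) : forall n, (n < i)%nat -> sinhc_conv i n = 0.
Proof.
  induction i as [|i IH]; intros n Hn; [lia|].
  simpl. apply sum_zero. intros [|k] Hk; simpl sinhc'; [ring|].
  rewrite IH by lia. ring.
Qed.

(* The coefficient of y^(2n) in (sinh(y/2)/(y/2))^r, expanded in powers of
   sinh(y/2)/(y/2) - 1 so that it makes sense, and is polynomial, for real r. *)
Definition spow (n : nat) (r : R) : R :=
  sum_f_R0 (fun i => gbin r i * sinhc_conv i n) n.

Lemma poly_spow (n : nat) : poly (S n) (spow n).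
Proof.
  apply poly_sum. intros k Hk.
  eapply poly_ext; [|apply (poly_scal _ (sinhc_conv k n)),
    (poly_weaken (S k)), (poly_gbin k); lia].
  intros; simpl; ring.
Qed.

Lemma spow_0 (n : nat) : spow n 0 = match n with O => 1 | _ => 0 end.
Proof.
  unfold spow. rewrite (sum_truncate _ 0 n).
  - simpl. ring.
  - lia.
  - intros [|k] Hk; [lia|]. rewrite gbin_0; ring.
Qed.

(** Multiplication by one more factor sinh(y/2)/(y/2), as a Cauchy product; Pascal's rule for [gbin]
    supplies it term by term. *)
Lemma spow_succ (n : nat) (r : R) :
  spow n (r + 1) = sum_f_R0 (fun l => sinhc l * spow (n - l) r) n.
Proof.
  assert (Ext : forall m M r', (m <= M)%nat ->
    sum_f_R0 (fun i => gbin r' i * sinhc_conv i m) M = spow m r').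
  { intros m M r' H. apply sum_truncate; [exact H|].
    intros k Hk. rewrite sinhc_conv_0 by lia. ring. }
  transitivity (spow n r + sum_f_R0 (fun l => sinhc' l * spow (n - l) r) n).
  - rewrite <- (Ext n (S n) (r + 1)) by lia. rewrite <- (Ext n (S n) r) by lia.
    rewrite !sum_head. simpl (gbin _ 0). rewrite Rplus_assoc. f_equal.
    transitivity (sum_f_R0 (fun k => gbin r (S k) * sinhc_conv (S k) n) n +
      sum_f_R0 (fun k => gbin r k * sinhc_conv (S k) n) n).
    + rewrite sum_add. apply sum_eq; intros. rewrite gbin_pascal; ring.
    + f_equal. simpl sinhc_conv.
      transitivity (sum_f_R0 (fun k => sum_f_R0 (fun l =>
        sinhc' l * (gbin r k * sinhc_conv k (n - l))) n) n).
      * apply sum_eq; intros. rewrite sum_mult_l. apply sum_eq; intros; ring.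
      * rewrite sum_exchange. apply sum_eq; intros l Hl.
        rewrite <- sum_mult_l, Ext by lia. reflexivity.
  - destruct n as [|n].
    + simpl. unfold sinhc. simpl. field.
    + rewrite !sum_head. simpl sinhc'. rewrite Nat.sub_0_r.
      unfold sinhc at 2. simpl. field.
Qed.

(** The exponent -1 gives the reciprocal series; this inverts the Euler-Maclaurin relations
    later. *)
Lemma spow_inv (n : nat) :
  sum_f_R0 (fun l => sinhc l * spow (n - l) (-1)) n =
  match n with O => 1 | _ => 0 end.
Proof.
  rewrite <- spow_succ, <- spow_0. f_equal. ring.
Qed.

(* The r-th central difference of [fun x => x ^ m] at 0. *)
Definition cdiff (r m : nat) : R :=
  sum_f_R0 (fun i => Binomial.C r i * ((-1) ^ i * (INR r / 2 - INR i) ^ m)) r.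

Lemma Rpow_diff_binomial (x : R) (m : nat) :
  (x + 1 / 2) ^ m - (x - 1 / 2) ^ m =
  sum_f_R0 (fun l => Binomial.C m l * ((1 / 2) ^ l - (- (1 / 2)) ^ l) * x ^ (m - l)) m.
Proof.
  replace (x + 1 / 2) with (1 / 2 + x) by ring.
  replace (x - 1 / 2) with (- (1 / 2) + x) by ring.
  rewrite !binomial, sum_sub. apply sum_eq; intros; ring.
Qed.

Lemma cdiff_succ (r m : nat) :
  cdiff (S r) m =
  sum_f_R0 (fun l => Binomial.C m l * ((1 / 2) ^ l - (- (1 / 2)) ^ l) * cdiff r (m - l)) m.
Proof.
  unfold cdiff. rewrite C_sum_succ.
  transitivity (sum_f_R0 (fun i => sum_f_R0 (fun l =>
    Binomial.C m l * ((1 / 2) ^ l - (- (1 / 2)) ^ l) *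
    (Binomial.C r i * ((-1) ^ i * (INR r / 2 - INR i) ^ (m - l)))) m) r).
  - apply sum_eq; intros i Hi.
    transitivity (Binomial.C r i * (-1) ^ i *
      ((INR r / 2 - INR i + 1 / 2) ^ m - (INR r / 2 - INR i - 1 / 2) ^ m)).
    + rewrite !S_INR.
      replace (INR r / 2 - INR i + 1 / 2) with ((INR r + 1) / 2 - INR i) by field.
      replace (INR r / 2 - INR i - 1 / 2) with ((INR r + 1) / 2 - (INR i + 1)) by field.
      simpl pow. ring.
    + rewrite Rpow_diff_binomial, sum_mult_l. apply sum_eq; intros; ring.
  - rewrite sum_exchange. apply sum_eq; intros l Hl. rewrite <- sum_mult_l. reflexivity.
Qed.

Lemma cdiff_0 (r : nat) : forall m, (m < r)%nat -> cdiff r m = 0.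
Proof.
  induction r as [|r IH]; intros m Hm; [lia|].
  rewrite cdiff_succ. apply sum_zero. intros [|l] Hl.
  - simpl. ring.
  - rewrite IH by lia. ring.
Qed.

(** The exponential generating function of [cdiff r] is (2 sinh(y/2))^r, that is y^r times the r-th
    power of sinh(y/2)/(y/2). *)
Lemma cdiff_spow (r : nat) : forall n,
  cdiff r (r + 2 * n) = INR (fact (r + 2 * n)) * spow n (INR r).
Proof.
  induction r as [|r IH]; intros n.
  - simpl INR. rewrite spow_0. unfold cdiff. simpl sum_f_R0.
    replace (0 / 2 - 0) with 0 by field.
    destruct n as [|n].
    + simpl. unfold Binomial.C. simpl. field.
    + replace (0 + 2 * S n)%nat with (S (2 * n + 1)) by lia. rewrite pow_i by lia. ring.
  - rewrite cdiff_succ, S_INR, spow_succ.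
    rewrite (sum_truncate _ (2 * n + 1)); [|lia|].
    2: { intros l Hl. rewrite cdiff_0 by lia. ring. }
    rewrite sum_odd.
    2: { intros i. rewrite !pow_mult.
         replace ((- (1 / 2)) ^ 2) with ((1 / 2) ^ 2) by ring. ring. }
    rewrite sum_mult_l. apply sum_eq; intros i Hi.
    replace (S r + 2 * n - (2 * i + 1))%nat with (r + 2 * (n - i))%nat by lia.
    rewrite IH. unfold Binomial.C, sinhc.
    replace (S r + 2 * n - (2 * i + 1))%nat with (r + 2 * (n - i))%nat by lia.
    rewrite !pow_add, !pow_mult.
    replace ((- (1 / 2)) ^ 2) with (/ 4) by field.
    replace ((1 / 2) ^ 2) with (/ 4) by field. rewrite pow_inv.
    field. repeat split; try apply INR_fact_neq_0. apply pow_nonzero; lra.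
Qed.

Lemma C_step (r i : nat) : (i <= r)%nat ->
  (INR i + 1) * (INR r + 1 - INR i) * Binomial.C (S (S r)) (S i) =
  (INR r + 2) * (INR r + 1) * Binomial.C r i.
Proof.
  intros Hi. unfold Binomial.C.
  replace (S (S r) - S i)%nat with (S (r - i)) by lia.
  rewrite !fact_simpl, !mult_INR, !S_INR, minus_INR by exact Hi.
  pose proof (pos_INR i). pose proof (le_INR _ _ Hi).
  field. repeat split; try apply INR_fact_neq_0; lra.
Qed.

(** For f = (2 sinh(y/2))^R with R = r + 2, this is the equation f'' = (R^2 / 4) f + R (R - 1) (2
    sinh(y/2))^(R-2), read on coefficients. *)
Lemma cdiff_rec (r m : nat) :
  cdiff (S (S r)) (m + 2) =
  (INR r + 2) ^ 2 / 4 * cdiff (S (S r)) m + (INR r + 2) * (INR r + 1) * cdiff r m.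
Proof.
  (* With R = r + 2 the node x_i = R/2 - i satisfies x_i^2 = R^2/4 - i (R - i). The factor i (R - i)
     vanishes at both ends and lowers the binomial coefficient by [C_step]. *)
  set (x := fun i => INR (S (S r)) / 2 - INR i).
  set (T := fun i => INR i * (INR (S (S r)) - INR i) * Binomial.C (S (S r)) i *
     ((-1) ^ i * x i ^ m)).
  assert (ET : - sum_f_R0 T (S (S r)) = (INR r + 2) * (INR r + 1) * cdiff r m).
  { rewrite tech5, sum_head.
    replace (T (S (S r))) with 0 by (unfold T; ring).
    replace (T 0%nat) with 0 by (unfold T; simpl INR; ring).
    unfold cdiff. rewrite sum_mult_l.
    replace (- (0 + sum_f_R0 (fun k => T (S k)) r + 0)) with
      ((-1) * sum_f_R0 (fun k => T (S k)) r) by ring.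
    rewrite sum_mult_l. apply sum_eq; intros i Hi. unfold T, x.
    replace (INR (S (S r)) / 2 - INR (S i)) with (INR r / 2 - INR i)
      by (rewrite !S_INR; field).
    rewrite <- (Rmult_assoc _ (Binomial.C r i)), <- (C_step r i Hi), !S_INR.
    simpl pow. field. }
  rewrite <- ET. unfold cdiff. rewrite sum_mult_l.
  replace (- sum_f_R0 T (S (S r))) with ((-1) * sum_f_R0 T (S (S r))) by ring.
  rewrite sum_mult_l, sum_add. apply sum_eq; intros i Hi. unfold T, x.
  rewrite pow_add, !S_INR. field.
Qed.

(** The same differential equation for real exponents: the difference of the two sides is polynomial
    in r and vanishes at every natural r >= 2. *)
Lemma spow_rec (n : nat) (r : R) :
  (r + 2 * INR (S n)) * (r + 2 * INR (S n) - 1) * spow (S n) r =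
  r ^ 2 / 4 * spow n r + r * (r - 1) * spow (S n) (r - 2).
Proof.
  set (P := fun r => (r + 2 * INR (S n)) * ((r + 2 * INR (S n) - 1) * spow (S n) r) -
    (r * (r * (/ 4 * spow n r)) + r * ((r - 1) * spow (S n) (r - 2)))).
  assert (HP : poly (n + 4) P).
  { unfold P. pose proof (poly_spow n) as H1. pose proof (poly_spow (S n)) as H2.
    pose proof (poly_affine _ 1 (-2) _ H2) as H3. cbv beta in H3.
    apply poly_minus; [|apply poly_plus].
    - replace (n + 4)%nat with (S (S (S (S n)))) by lia.
      eapply poly_ext; [|apply (poly_linear _ 1 (2 * INR (S n))),
        (poly_linear _ 1 (2 * INR (S n) - 1)), H2]. intros; simpl; ring.
    - eapply poly_ext; [|apply (poly_weaken (S (S (S n)))); [lia|];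
        apply (poly_linear _ 1 0), (poly_linear _ 1 0), (poly_scal _ (/ 4)), H1].
      intros; simpl; ring.
    - replace (n + 4)%nat with (S (S (S (S n)))) by lia.
      eapply poly_ext; [|apply (poly_linear _ 1 0), (poly_linear _ 1 (-1)), H3].
      intros x; cbv beta. replace (1 * x + -2) with (x - 2) by ring. ring. }
  assert (HZ : P r = 0).
  (* Shifting by 2 makes both exponents r and r - 2 natural at the test points. *)
  { replace r with (1 * (r - 2) + 2) by ring.
    apply (poly_eq_0 _ _ (poly_affine _ 1 2 _ HP)). intros j. unfold P.
    pose proof (cdiff_rec j (j + 2 * S n)) as E.
    replace (j + 2 * S n + 2)%nat with (S (S j) + 2 * S n)%nat in E by lia.
    replace (j + 2 * S n)%nat with (S (S j) + 2 * n)%nat in E at 1 by lia.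
    rewrite !cdiff_spow in E.
    replace (S (S j) + 2 * S n)%nat with (S (S (S (S j) + 2 * n))) in E by lia.
    replace (j + 2 * S n)%nat with (S (S j) + 2 * n)%nat in E by lia.
    assert (Em : INR (S (S j) + 2 * n) = INR j + 2 + 2 * INR n)
      by (rewrite plus_INR, mult_INR, !S_INR; simpl; ring).
    set (m := (S (S j) + 2 * n)%nat) in *. clearbody m.
    rewrite !fact_simpl, !mult_INR, !(S_INR (S m)), !(S_INR m), Em in E.
    rewrite !S_INR in *. pose proof (INR_fact_pos m) as HF.
    replace (1 * INR j + 2) with (INR j + 1 + 1) by ring.
    replace (INR j + 1 + 1 - 2) with (INR j) by ring.
    apply (Rmult_eq_reg_l (INR (fact m))); [|lra]. rewrite Rmult_0_r.
    match type of E with ?A = ?B => transitivity (A - B); [field|lra] end. }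
  unfold P in HZ. lra.
Qed.

(** * Moment polynomials *)

Definition rho (d : nat) : R := (INR d - 1) / 2.

Definition prev (p : nat -> R -> R) (n : nat) (s : R) : R :=
  match n with O => 0 | S n' => p n' s end.

(* If r denotes the geodesic distance from a fixed point, the coefficient of
   t^(s+n) in exp(-t(Delta + rho^2)) applied to (2 sin(r/2))^(2s), taken at that
   point, is [p n s] up to a factor that depends only on s and d. *)
Definition moment_coeffs (d : nat) (p : nat -> R -> R) : Prop :=
  (forall n, poly (S (2 * n)) (p n)) /\
  (forall s, p 0%nat s = 1) /\
  (forall n s, (s + INR n) * p n s - s * p n (s - 1) = - (s + rho d) ^ 2 * prev p n s).

Lemma poly_rise (n m : nat) (a : R) (f : R -> R) :
  poly m f -> poly (n + m) (fun s => rise (s + a) n * f s).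
Proof.
  intros Hf. induction n as [|n IH].
  - eapply poly_ext; [|exact Hf]. intros; simpl; ring.
  - eapply poly_ext; [|apply (poly_linear _ 1 (a + INR n)), IH].
    intros x; simpl; ring.
Qed.

Lemma poly_base (n : nat) (a b : R) :
  poly (S (2 * n)) (fun s => (-4) ^ n * rise (s + a) n * spow n (2 * s + b)).
Proof.
  replace (S (2 * n)) with (n + S n)%nat by lia.
  eapply poly_ext; [|apply (poly_scal _ ((-4) ^ n)), (poly_rise n (S n) a),
    (poly_affine _ 2 b), poly_spow].
  intros; simpl; ring.
Qed.

(** The rising factorial absorbs the factors r + 2n - 1 and r - 1 of [spow_rec] at r = 2s, which
    leaves the recursion with rho = 0. *)
Definition moments_circle (n : nat) (s : R) : R :=
  (-4) ^ n * rise (s + 1 / 2) n * spow n (2 * s).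

(** Here r = 2s + 1, and the rising factorial absorbs r + 2n and r instead. *)
Definition moments_sphere (n : nat) (s : R) : R :=
  (-4) ^ n * rise (s + 3 / 2) n * spow n (2 * s + 1).

Lemma spow_O (r : R) : spow 0 r = 1.
Proof. unfold spow; simpl; ring. Qed.

Lemma moment_coeffs_circle : moment_coeffs 1 moments_circle.
Proof.
  unfold moments_circle. repeat split.
  - intros n. eapply poly_ext; [|apply (poly_base n (1 / 2) 0)].
    intros; cbv beta; rewrite Rplus_0_r; reflexivity.
  - intros s. rewrite spow_O. simpl; ring.
  - intros [|n] s; unfold rho; simpl prev.
    + rewrite !spow_O. simpl; ring.
    + replace (rise (s - 1 + 1 / 2) (S n)) with ((s - 1 / 2) * rise (s + 1 / 2) n).
      2: { rewrite rise_head. f_equal; [field|]. f_equal. field. }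
      simpl rise. pose proof (spow_rec n (2 * s)) as E.
      replace (2 * (s - 1)) with (2 * s - 2) by ring.
      simpl (INR 1). rewrite S_INR in *. simpl pow.
      set (A := (-4) ^ n) in *. set (Q := rise (s + 1 / 2) n) in *.
      transitivity (- A * Q * ((2 * s + 2 * (INR n + 1)) * (2 * s + 2 * (INR n + 1) - 1) *
        spow (S n) (2 * s) - 2 * s * (2 * s - 1) * spow (S n) (2 * s - 2))); [field|].
      rewrite E. field.
Qed.

Lemma moment_coeffs_sphere : moment_coeffs 2 moments_sphere.
Proof.
  unfold moments_sphere. repeat split.
  - intros n. apply poly_base.
  - intros s. rewrite spow_O. simpl; ring.
  - intros [|n] s; unfold rho; simpl prev.
    + rewrite !spow_O. simpl; ring.
    + replace (rise (s - 1 + 3 / 2) (S n)) with ((s + 1 / 2) * rise (s + 3 / 2) n).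
      2: { rewrite rise_head. f_equal; [field|]. f_equal. field. }
      simpl rise. pose proof (spow_rec n (2 * s + 1)) as E.
      replace (2 * (s - 1) + 1) with (2 * s + 1 - 2) by ring.
      simpl (INR 2). rewrite S_INR in *. simpl pow.
      set (A := (-4) ^ n) in *. set (Q := rise (s + 3 / 2) n) in *.
      transitivity (- A * Q * ((2 * s + 1 + 2 * (INR n + 1)) * (2 * s + 1 + 2 * (INR n + 1) - 1) *
        spow (S n) (2 * s + 1) - (2 * s + 1) * (2 * s + 1 - 1) * spow (S n) (2 * s + 1 - 2)));
        [field|].
      rewrite E. field.
Qed.

Definition moments_lift (d : nat) (p : nat -> R -> R) (n : nat) (s : R) : R :=
  p n s - (s + INR d) * prev p n (s + 1).

(** Combine the recursions at (n, s) and (n - 1, s + 1). What remains is - (2s + d) p_(n-1)(s), and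
    (s + rho)^2 + 2s + d = (s + rho + 1)^2. *)
Lemma moment_coeffs_lift (d : nat) (p : nat -> R -> R) :
  moment_coeffs d p -> moment_coeffs (S (S d)) (moments_lift d p).
Proof.
  unfold moments_lift. intros (Hp & H0 & Hr). repeat split.
  - intros [|n]; simpl prev.
    + eapply poly_ext; [|apply (Hp 0%nat)]. intros; simpl; ring.
    + apply poly_minus; [apply Hp|].
      eapply poly_ext; [|apply (poly_linear _ 1 (INR d)), (poly_weaken (S (2 * n))),
        (poly_affine _ 1 1 _ (Hp n)); lia].
      intros x; cbv beta. f_equal; [ring|]. f_equal; ring.
  - intros s; simpl. rewrite H0; ring.
  - intros [|n] s; simpl prev.
    + simpl. rewrite !H0; ring.
    + pose proof (Hr (S n) s) as E1. pose proof (Hr n (s + 1)) as E2. simpl prev in E1.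
      replace (s - 1 + 1) with s by ring. replace (s + 1 - 1) with s in E2 by ring.
      unfold rho in *. rewrite !S_INR in *.
      transitivity ((s + (INR n + 1)) * p (S n) s - s * p (S n) (s - 1)
        - (s + INR d) * ((s + 1 + INR n) * p n (s + 1) - (s + 1) * p n s)
        - (s + INR d) * (s + 1) * p n s + s * (s + INR d - 1) * p n s); [ring|].
      rewrite E1, E2. field.
Qed.

(** The new point - (d + 2)/2 lies one step below - d/2, so the recursion at - d/2 expresses the
    lift by values at - d/2 alone, in the form met by the traces. *)
Lemma moments_lift_diag (d : nat) (p : nat -> R -> R) (n : nat) :
  (1 <= d)%nat -> moment_coeffs d p ->
  moments_lift d p n (- (INR (S (S d)) / 2)) =
  2 / INR d * ((INR d / 2 - INR n) * p n (- (INR d / 2)) -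
    rho d ^ 2 * prev p n (- (INR d / 2))).
Proof.
  intros Hd (_ & _ & Hr). assert (0 < INR d) by (apply lt_0_INR; lia).
  unfold moments_lift. specialize (Hr n (- (INR d / 2))).
  rewrite !S_INR.
  replace (- ((INR d + 1 + 1) / 2) + 1) with (- (INR d / 2)) by field.
  replace (- (INR d / 2) - 1) with (- ((INR d + 1 + 1) / 2)) in Hr by field.
  apply (Rmult_eq_reg_l (INR d / 2)); [|lra].
  rewrite <- (Rmult_assoc (INR d / 2) (2 / INR d)).
  replace (INR d / 2 * (2 / INR d)) with 1 by (field; lra).
  unfold rho in *. nra.
Qed.

(** * The sums over the spectrum *)

Definition exp_conv (kappa : R) (c : nat -> R) (n : nat) : R :=
  sum_f_R0 (fun i => kappa ^ i / INR (fact i) * c (n - i)%nat) n.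

(** Puts back the factor exp(t rho^2): these are the p_n of Delta itself, without the shift by
    rho^2. *)
Definition moments (d : nat) (p : nat -> R -> R) (n : nat) (s : R) : R :=
  exp_conv (rho d ^ 2) (fun m => p m s) n.

(** The index in s + n splits between the two factors of the convolution; the exponential's share
    contributes rho^2, and (s + rho)^2 - rho^2 = s (s + d - 1). *)
Lemma moments_rec (d : nat) (p : nat -> R -> R) (n : nat) (s : R) :
  moment_coeffs d p ->
  (s + INR (S n)) * moments d p (S n) s - s * moments d p (S n) (s - 1) =
  - s * (s + INR d - 1) * moments d p n s.
Proof.
  intros (_ & _ & Hr). unfold moments, exp_conv.
  set (e := fun i => (rho d ^ 2) ^ i / INR (fact i)).
  transitivity (sum_f_R0 (fun i => e i * (- (s + rho d) ^ 2 * prev p (S n - i) s)) (S n) +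
    sum_f_R0 (fun i => INR i * e i * p (S n - i)%nat s) (S n)).
  - rewrite !sum_mult_l, sum_sub, sum_add. apply sum_eq; intros i Hi.
    fold (e i). rewrite <- Hr, minus_INR by exact Hi. ring.
  - rewrite (tech5 _ n), Nat.sub_diag, (sum_head (fun i => INR i * _ * _)).
    simpl (prev p 0 s). simpl (INR 0).
    rewrite sum_mult_l.
    match goal with |- ?A + ?B + (?C + ?D) = ?E => transitivity (A + D); [ring|] end.
    rewrite sum_add. apply sum_eq; intros i Hi.
    replace (S n - i)%nat with (S (n - i)) by lia.
    rewrite Nat.sub_succ. simpl (prev p (S (n - i)) s). unfold e, rho.
    rewrite fact_simpl, mult_INR, S_INR. simpl pow.
    pose proof (pos_INR i). field. split; [apply INR_fact_neq_0|lra].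
Qed.

Lemma poly_moments (d : nat) (p : nat -> R -> R) (n : nat) :
  moment_coeffs d p -> poly (S (2 * n)) (moments d p n).
Proof.
  intros (Hp & _). apply (poly_sum (S (2 * n))). intros k Hk.
  apply poly_scal. apply (poly_weaken (S (2 * (n - k)))); [lia|apply Hp].
Qed.

Lemma moments_0 (d : nat) (p : nat -> R -> R) (s : R) :
  moment_coeffs d p -> moments d p 0 s = 1.
Proof.
  intros (_ & H0 & _). unfold moments, exp_conv. simpl. rewrite H0. field.
Qed.

(** The inner sum of the theorem with a free exponent m and the term k = 0 added, which is zero for
    m >= 1. *)
Definition spectral_sum (d j m : nat) : R :=
  sum_f_R0 (fun k => (-1) ^ k * Binomial.C (2 * j + d - 1) (j - k) *
    mu k d * lambda k d ^ m) j.

(** A form of the multiplicity free of natural subtraction. *)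
Lemma mu_succ (k e : nat) :
  mu (S k) (S e) = (2 * INR k + INR e + 2) * INR (fact (k + e)) /
    (INR (fact (S k)) * INR (fact e)).
Proof.
  unfold mu. replace (S k + S e - 2)%nat with (k + e)%nat by lia.
  replace (2 * S k + S e - 1)%nat with (2 * k + e + 2)%nat by lia.
  replace (S e - 1)%nat with e by lia.
  rewrite !plus_INR, mult_INR. reflexivity.
Qed.

(** lambda_(j+1) - lambda_k = (j + 1 - k)(j + k + d), exactly the factors that turn the binomial
    coefficient for j + 1 into the one for j; the term k = j + 1 drops out. *)
Lemma spectral_sum_succ (d j m : nat) : (1 <= d)%nat ->
  spectral_sum d (S j) (S m) =
  lambda (S j) d * spectral_sum d (S j) m -
  (2 * INR j + INR d + 1) * (2 * INR j + INR d) * spectral_sum d j m.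
Proof.
  intros Hd. destruct d as [|e]; [lia|]. unfold spectral_sum.
  rewrite (tech5 _ j), (tech5 _ j), Rmult_plus_distr_l, !sum_mult_l.
  match goal with |- ?A + ?B = ?C + ?D - ?E =>
    replace D with B by (simpl pow; ring); cut (A = C - E); [intros ->; ring|] end.
  rewrite sum_sub. apply sum_eq; intros k Hk.
  cut ((lambda (S j) (S e) - lambda k (S e)) * Binomial.C (2 * S j + S e - 1) (S j - k) =
    (2 * INR j + INR (S e) + 1) * (2 * INR j + INR (S e)) *
    Binomial.C (2 * j + S e - 1) (j - k)).
  { intros E. apply Rminus_diag_uniq. simpl pow.
    transitivity ((-1) ^ k * mu k (S e) * lambda k (S e) ^ m *
      ((2 * INR j + INR (S e) + 1) * (2 * INR j + INR (S e)) *
        Binomial.C (2 * j + S e - 1) (j - k) -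
       (lambda (S j) (S e) - lambda k (S e)) * Binomial.C (2 * S j + S e - 1) (S j - k)));
      [ring|rewrite E; ring]. }
  unfold lambda, Binomial.C.
  replace (2 * S j + S e - 1 - (S j - k))%nat with (S (j + k + e)) by lia.
  replace (2 * j + S e - 1 - (j - k))%nat with (j + k + e)%nat by lia.
  replace (2 * S j + S e - 1)%nat with (S (S (2 * j + e))) by lia.
  replace (2 * j + S e - 1)%nat with (2 * j + e)%nat by lia.
  replace (S j - k)%nat with (S (j - k)) by lia.
  rewrite !fact_simpl, !mult_INR, !S_INR, !plus_INR, minus_INR by exact Hk.
  rewrite mult_INR. simpl (INR 2). pose proof (pos_INR k). pose proof (pos_INR e).
  pose proof (le_INR _ _ Hk).
  field. repeat split; try apply INR_fact_neq_0; lra.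
Qed.

(* The partial sums have a closed form, found by Gosper summation. *)
Lemma spectral_sum_0 (d j : nat) : (1 <= d)%nat -> spectral_sum d (S j) 0 = 0.
Proof.
  intros Hd. destruct d as [|e]; [lia|]. unfold spectral_sum.
  set (T := fun k => (-1) ^ k * Binomial.C (2 * S j + S e - 1) (S j - k) *
    mu k (S e) * lambda k (S e) ^ 0).
  assert (EK : forall K, (K <= j)%nat -> sum_f_R0 T K =
    INR (fact (2 * j + e + 2)) / (INR (fact e) * (INR j + 1)) *
    ((-1) ^ K * INR (fact (K + e)) /
     (INR (fact K) * INR (fact (j - K)) * INR (fact (j + K + e + 1))))).
  { intros K. induction K as [|K IH]; intros HK.
    - unfold T, Binomial.C. cbn [sum_f_R0 mu pow].
      replace (2 * S j + S e - 1 - (S j - 0))%nat with (j + 0 + e + 1)%nat by lia.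
      replace (2 * S j + S e - 1)%nat with (2 * j + e + 2)%nat by lia.
      rewrite !Nat.sub_0_r, (fact_simpl j), mult_INR, S_INR.
      change (INR (fact 0)) with 1. change (0 + e)%nat with e.
      pose proof (pos_INR j).
      field. repeat split; try apply INR_fact_neq_0; lra.
    - rewrite tech5, IH by lia. unfold T, Binomial.C. rewrite mu_succ.
      replace (2 * S j + S e - 1 - (S j - S K))%nat with (S (j + K + e + 1)) by lia.
      replace (2 * S j + S e - 1)%nat with (2 * j + e + 2)%nat by lia.
      replace (j + S K + e + 1)%nat with (S (j + K + e + 1)) by lia.
      replace (S j - S K)%nat with (S (j - S K)) by lia.
      replace (j - K)%nat with (S (j - S K)) by lia.
      replace (S K + e)%nat with (S (K + e)) by lia.
      rewrite !(fact_simpl (j - S K)), !(fact_simpl (j + K + e + 1)),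
        !(fact_simpl K), !(fact_simpl (K + e)).
      rewrite !mult_INR, !S_INR, !plus_INR, minus_INR by exact HK.
      rewrite !S_INR. simpl pow. simpl (INR 0).
      pose proof (pos_INR K). pose proof (pos_INR e). pose proof (pos_INR j).
      pose proof (le_INR _ _ HK) as HK'. rewrite S_INR in HK'.
      field. repeat split; try apply INR_fact_neq_0; lra. }
  (* The last term k = j + 1 cancels the closed form at K = j. *)
  rewrite tech5, EK by lia. unfold T. rewrite mu_succ. unfold Binomial.C.
  replace (2 * S j + S e - 1 - (S j - S j))%nat with (S (S (2 * j + e))) by lia.
  replace (2 * S j + S e - 1)%nat with (S (S (2 * j + e))) by lia.
  replace (2 * j + e + 2)%nat with (S (S (2 * j + e))) by lia.
  replace (j + j + e + 1)%nat with (S (2 * j + e)) by lia.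
  rewrite !Nat.sub_diag. change (INR (fact 0)) with 1.
  rewrite !fact_simpl, !mult_INR, !S_INR, !plus_INR, mult_INR. simpl (INR 2). simpl pow.
  pose proof (pos_INR e). pose proof (pos_INR j).
  field. repeat split; try apply INR_fact_neq_0; lra.
Qed.

Lemma spectral_sum_lt (d : nat) (m : nat) : (1 <= d)%nat ->
  forall j, (m < j)%nat -> spectral_sum d j m = 0.
Proof.
  intros Hd. induction m as [|m IH]; intros [|j] Hj; try lia.
  - apply spectral_sum_0, Hd.
  - rewrite spectral_sum_succ, !IH by lia. ring.
Qed.

(** At s = 0 only (n + 1) times this value survives in the recursion. Hence the node j = 0
    contributes nothing to the final sum. *)
Lemma moments_at_0 (d : nat) (p : nat -> R -> R) (n : nat) :
  moment_coeffs d p -> moments d p (S n) 0 = 0.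
Proof.
  intros Hp. pose proof (moments_rec d p n 0 Hp) as E.
  assert (0 < INR (S n)) by (apply lt_0_INR; lia). nra.
Qed.

(** Both sides obey the same recursion, [spectral_sum_succ] on the left and [moments_rec] at s = j +
    1 on the right, with equal values at j = 0 and at n = 0. *)
Lemma spectral_sum_moments (d : nat) (p : nat -> R -> R) :
  (1 <= d)%nat -> moment_coeffs d p -> forall j n,
  spectral_sum d j (j + n) =
  (-1) ^ (j + n) * INR (fact (j + n)) * INR (fact (2 * j + d - 1)) /
    (INR (fact (d - 1)) * INR (fact j)) * moments d p n (INR j).
Proof.
  intros Hd Hp. induction j as [|j IHj].
  - intros [|n].
    + unfold spectral_sum. rewrite (moments_0 d p _ Hp). cbn [sum_f_R0 mu pow Nat.add].
      unfold Binomial.C. rewrite Nat.sub_diag, Nat.sub_0_r.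
      replace (2 * 0 + d - 1)%nat with (d - 1)%nat by lia.
      change (INR (fact 0)) with 1. field. apply INR_fact_neq_0.
    + rewrite moments_at_0 by exact Hp. unfold spectral_sum, lambda. simpl. ring.
  - assert (Hpos := pos_INR j). assert (HdR := le_INR _ _ Hd). simpl (INR 1) in HdR.
    assert (HF : INR (fact (2 * S j + d - 1)) =
      (2 * INR j + INR d + 1) * ((2 * INR j + INR d) * INR (fact (2 * j + d - 1)))).
    { replace (2 * S j + d - 1)%nat with (S (S (2 * j + d - 1))) by lia.
      rewrite !fact_simpl, !mult_INR, !S_INR, minus_INR, plus_INR, mult_INR by lia.
      simpl (INR 2). simpl (INR 1). ring. }
    induction n as [|n IHn].
    + replace (S j + 0)%nat with (S j) by lia.
      rewrite spectral_sum_succ, (spectral_sum_lt d j Hd (S j)) by lia.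
      pose proof (IHj 0%nat) as E. rewrite Nat.add_0_r in E. rewrite E, HF.
      rewrite !(moments_0 d p _ Hp), (fact_simpl j), !mult_INR, S_INR. simpl pow.
      field. repeat split; try apply INR_fact_neq_0; lra.
    + replace (S j + S n)%nat with (S (S j + n)) by lia.
      rewrite spectral_sum_succ, IHn by lia.
      replace (S j + n)%nat with (j + S n)%nat by lia. rewrite IHj, HF.
      pose proof (moments_rec d p n (INR (S j)) Hp) as E.
      replace (INR (S j) - 1) with (INR j) in E by (rewrite S_INR; ring).
      rewrite (fact_simpl (j + S n)), (fact_simpl j), !mult_INR.
      rewrite (S_INR (j + S n)), plus_INR. unfold lambda.
      rewrite !S_INR in *. simpl pow.
      set (P1 := moments d p (S n) (INR j + 1)) in *.
      set (P2 := moments d p (S n) (INR j)) in *.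
      set (P3 := moments d p n (INR j + 1)) in *.
      set (A := (-1) ^ (j + S n)).
      assert (E' : (INR j + (INR n + 1) + 1) * P1 =
        (INR j + 1) * P2 - (INR j + 1) * (INR j + 1 + INR d - 1) * P3) by lra.
      set (F := INR (fact (j + S n))). set (G := INR (fact (2 * j + d - 1))).
      transitivity (- A * F * G * (2 * INR j + INR d + 1) * (2 * INR j + INR d) /
        (INR (fact (d - 1)) * ((INR j + 1) * INR (fact j))) *
        ((INR j + 1) * P2 - (INR j + 1) * (INR j + 1 + INR d - 1) * P3)).
      * field. repeat split; try apply INR_fact_neq_0; lra.
      * rewrite <- E'. field. repeat split; try apply INR_fact_neq_0; lra.
Qed.

(** * Derivatives of Gaussian moments *)

(* Restores the carrier [R] in equations stated in Coquelicot's structures. *)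
Ltac R_eq := match goal with |- @eq _ ?a ?b => change (@eq R a b) end.

(** The m-th derivative of exp(- y^2), by the three-term recursion of the Hermite polynomials. *)
Fixpoint gauss (m : nat) (y : R) : R :=
  match m with
  | O => exp (- (y * y))
  | S m' =>
      match m' with
      | O => - 2 * y * exp (- (y * y))
      | S m'' => - 2 * y * gauss m' y - 2 * INR m' * gauss m'' y
      end
  end.

Lemma gauss_SS (m : nat) (y : R) :
  gauss (S (S m)) y = - 2 * y * gauss (S m) y - 2 * (INR m + 1) * gauss m y.
Proof. rewrite <- S_INR. reflexivity. Qed.

Lemma nat_ind2 (P : nat -> Prop) :
  P 0%nat -> P 1%nat -> (forall n, P n -> P (S n) -> P (S (S n))) -> forall n, P n.
Proof.
  intros H0 H1 HS n. cut (P n /\ P (S n)); [tauto|].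
  induction n as [|n IH]; [auto|]. destruct IH; auto.
Qed.

Lemma is_derive_affine_comb (f g : R -> R) (x df dg c e : R) :
  is_derive f x df -> is_derive g x dg ->
  is_derive (fun y => c * (y * f y) + e * g y) x (c * (f x + x * df) + e * dg).
Proof.
  intros Hf Hg.
  apply (is_derive_plus (fun y => c * (y * f y)) (fun y => e * g y));
    [|apply is_derive_scal, Hg].
  apply (is_derive_scal (fun y => y * f y)). evar_last.
  - apply (is_derive_mult (fun y => y) f); [apply is_derive_id|exact Hf|].
    intros; apply Rmult_comm.
  - unfold plus, mult, one; simpl. ring.
Qed.

Lemma is_derive_gauss (m : nat) (y : R) : is_derive (gauss m) y (gauss (S m) y).
Proof.
  revert y. induction m as [| |m IH0 IH1] using nat_ind2; intros y.
  - simpl. auto_derive; [auto|ring].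
  - rewrite gauss_SS. simpl. auto_derive; [auto|ring].
  - rewrite (gauss_SS (S m)).
    apply (is_derive_ext (fun y => - 2 * (y * gauss (S m) y) + - 2 * (INR m + 1) * gauss m y)).
    { intros t. rewrite gauss_SS. R_eq; ring. }
    evar_last; [apply is_derive_affine_comb; [apply IH1|apply IH0]|].
    rewrite S_INR. simpl. ring.
Qed.

Definition rapid (f : R -> R) : Prop :=
  forall p : nat, exists C, forall y, Rabs y ^ p * Rabs (f y) <= C.

Lemma rapid_plus (f g : R -> R) :
  rapid f -> rapid g -> rapid (fun y => f y + g y).
Proof.
  intros Hf Hg p. destruct (Hf p) as [C HC], (Hg p) as [D HD].
  exists (C + D). intros y. specialize (HC y). specialize (HD y).
  pose proof (Rabs_triang (f y) (g y)).
  pose proof (pow_le (Rabs y) p (Rabs_pos y)). nra.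
Qed.

Lemma rapid_scal (a : R) (f : R -> R) : rapid f -> rapid (fun y => a * f y).
Proof.
  intros Hf p. destruct (Hf p) as [C HC].
  exists (Rabs a * C). intros y. specialize (HC y).
  rewrite Rabs_mult. pose proof (Rabs_pos a). nra.
Qed.

Lemma rapid_mult_id (f : R -> R) : rapid f -> rapid (fun y => y * f y).
Proof.
  intros Hf p. destruct (Hf (S p)) as [C HC].
  exists C. intros y. specialize (HC y). rewrite Rabs_mult. simpl in HC. lra.
Qed.

Lemma rapid_ext (f g : R -> R) : (forall y, g y = f y) -> rapid f -> rapid g.
Proof.
  intros E Hf p. destruct (Hf p) as [C HC]. exists C. intros; rewrite E; auto.
Qed.

Lemma exp_pow_nat (x : R) (n : nat) : exp x ^ n = exp (INR n * x).
Proof.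
  induction n as [|n IH].
  - simpl. rewrite Rmult_0_l, exp_0; reflexivity.
  - rewrite S_INR. simpl pow. rewrite IH, <- exp_plus. f_equal; ring.
Qed.

Lemma exp_le_1 (z : R) : 0 <= z -> exp (- z) <= 1.
Proof.
  intros [Hz|<-].
  - rewrite <- exp_0. left. apply exp_increasing. lra.
  - rewrite Ropp_0, exp_0. lra.
Qed.

(** Raise z / n <= exp(z / n) to the n-th power. *)
Lemma pow_le_exp (n : nat) (z : R) : 0 <= z -> z ^ n <= INR n ^ n * exp z.
Proof.
  intros Hz. destruct n as [|n].
  - simpl. pose proof (exp_ineq1_le z). lra.
  - assert (Hn : 0 < INR (S n)) by (apply lt_0_INR; lia).
    replace z with (INR (S n) * (z / INR (S n))) at 1 by (field; lra).
    rewrite Rpow_mult_distr. apply Rmult_le_compat_l; [apply pow_le; lra|].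
    replace z with (INR (S n) * (z / INR (S n))) at 2 by (field; lra).
    rewrite <- exp_pow_nat. apply pow_incr. split.
    + apply Rdiv_le_0_compat; lra.
    + pose proof (exp_ineq1_le (z / INR (S n))). lra.
Qed.

Lemma rapid_gauss (m : nat) : rapid (gauss m).
Proof.
  assert (H0 : rapid (fun y => exp (- (y * y)))).
  { intros p. exists (1 + INR p ^ p). intros y.
    rewrite (Rabs_pos_eq (exp _)) by (left; apply exp_pos).
    assert (Hy : Rabs y ^ p <= 1 + (y * y) ^ p).
    { destruct (Rle_dec (Rabs y) 1) as [Hy|Hy].
      - pose proof (pow_incr (Rabs y) 1 p (conj (Rabs_pos y) Hy)) as E.
        rewrite pow1 in E. pose proof (pow_le (y * y) p (Rle_0_sqr y)). lra.
      - cut (Rabs y ^ p <= (y * y) ^ p); [lra|].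
        apply pow_incr. split; [apply Rabs_pos|].
        replace (y * y) with (Rabs y * Rabs y)
          by (rewrite <- Rabs_mult; apply Rabs_pos_eq, Rle_0_sqr).
        nra. }
    pose proof (pow_le_exp p (y * y) (Rle_0_sqr y)) as E.
    pose proof (exp_pos (- (y * y))) as HE.
    assert (E1 : exp (y * y) * exp (- (y * y)) = 1).
    { rewrite <- exp_plus. replace (y * y + - (y * y)) with 0 by ring. apply exp_0. }
    assert (exp (- (y * y)) <= 1).
    { apply exp_le_1, Rle_0_sqr. }
    apply Rle_trans with ((1 + INR p ^ p * exp (y * y)) * exp (- (y * y))).
    - apply Rmult_le_compat_r; lra.
    - rewrite Rmult_plus_distr_r, Rmult_assoc, E1. lra. }
  induction m as [| |m IH0 IH1] using nat_ind2.
  - exact H0.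
  - eapply rapid_ext; [|apply (rapid_scal (-2)), rapid_mult_id, H0]. intros; simpl; ring.
  - eapply rapid_ext; [|apply rapid_plus;
      [apply (rapid_scal (-2)), rapid_mult_id, IH1|apply (rapid_scal (- 2 * (INR m + 1))), IH0]].
    intros; rewrite gauss_SS; ring.
Qed.

Lemma continuous_gauss (m : nat) (y : R) : continuous (gauss m) y.
Proof. apply (ex_derive_continuous (gauss m)). eexists; apply is_derive_gauss. Qed.

Lemma continuity_pt_is_derive (f : R -> R) (x l : R) :
  is_derive f x l -> continuity_pt f x.
Proof.
  intros H. apply derivable_continuous_pt. exists l. apply is_derive_Reals, H.
Qed.

Lemma is_derive_MVT (f df : R -> R) (a b : R) :
  (forall x, is_derive f x (df x)) ->
  exists c, Rmin a b <= c <= Rmax a b /\ f b - f a = df c * (b - a).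
Proof.
  intros H. apply MVT_gen; intros; [apply H|].
  eapply continuity_pt_is_derive, H.
Qed.

(** * The Gaussian integral and antiderivatives of Gaussian moments *)

Definition erfint (y : R) : R := RInt (gauss 0) 0 y.

Lemma is_derive_erfint (y : R) : is_derive erfint y (gauss 0 y).
Proof.
  apply (is_derive_RInt (gauss 0) erfint 0 y); [|apply continuous_gauss].
  apply filter_forall. intros b. apply (RInt_correct (gauss 0)), (ex_RInt_continuous (gauss 0)).
  intros; apply continuous_gauss.
Qed.

Lemma erfint_incr (a b : R) : a <= b -> erfint a <= erfint b.
Proof.
  intros Hab. destruct (is_derive_MVT erfint (gauss 0) a b is_derive_erfint) as (c & _ & E).
  pose proof (exp_pos (- (c * c))). simpl gauss in E. nra.
Qed.

(* Since [y * y >= y - 1], the increments of [erfint] are below those of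
   [fun y => - exp (1 - y)]. *)
Lemma erfint_tail (a b : R) : a <= b -> erfint b - erfint a <= exp (1 - a).
Proof.
  intros Hab.
  destruct (is_derive_MVT (fun y => erfint y + exp (1 - y))
    (fun y => gauss 0 y + - exp (1 - y)) a b) as (c & _ & E).
  - intros x. apply (is_derive_plus erfint (fun y => exp (1 - y))).
    + apply is_derive_erfint.
    + auto_derive; [auto|]. R_eq; unfold Rminus; ring.
  - assert (exp (- (c * c)) <= exp (1 - c)).
    { destruct (Rle_lt_or_eq_dec (- (c * c)) (1 - c)) as [H|H]; [nra| |].
      - left; apply exp_increasing, H.
      - rewrite H; lra. }
    pose proof (exp_pos (1 - b)). simpl gauss in E. nra.
Qed.

Definition erfint_lim : R := real (Lim_seq (fun n => erfint (INR n))).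

Lemma is_lim_seq_erfint : is_lim_seq (fun n => erfint (INR n)) erfint_lim.
Proof.
  apply Lim_seq_correct'.
  apply (ex_finite_lim_seq_incr _ (erfint 0 + exp (1 - 0))).
  - intros n. apply erfint_incr. rewrite S_INR. lra.
  - intros n. pose proof (erfint_tail 0 (INR n) (pos_INR n)). lra.
Qed.

Lemma erfint_lim_tail (a : R) : 0 <= erfint_lim - erfint a <= exp (1 - a).
Proof.
  destruct (nfloor_ex (Rmax 0 a) (Rmax_l _ _)) as [N HN].
  assert (HN' : forall n, a <= INR (n + S N)).
  { intros n. rewrite plus_INR, S_INR. pose proof (pos_INR n). pose proof (Rmax_r 0 a). lra. }
  pose proof (proj1 (is_lim_seq_incr_n _ (S N) _) is_lim_seq_erfint) as HL. split.
  - cut (erfint a <= erfint_lim); [lra|].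
    apply (is_lim_seq_le (fun _ => erfint a) (fun n => erfint (INR (n + S N)))
      (erfint a) erfint_lim); [|apply is_lim_seq_const|exact HL].
    intros n. apply erfint_incr, HN'.
  - cut (erfint_lim <= erfint a + exp (1 - a)); [lra|].
    apply (is_lim_seq_le (fun n => erfint (INR (n + S N))) (fun _ => erfint a + exp (1 - a))
      erfint_lim (erfint a + exp (1 - a))); [|exact HL|apply is_lim_seq_const].
    intros n. pose proof (erfint_tail a _ (HN' n)). lra.
Qed.

(* [moment_deriv r 0] is the antiderivative of [fun y => y ^ r * exp (- y ^ 2)]
   that vanishes at infinity and [moment_deriv r m] is its m-th derivative.  The
   last equation is the m-th derivative of
   [2 y^(r'+2) exp(-y^2) = r' y^r' exp(-y^2) - y (y^r' exp(-y^2))']. *)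
Fixpoint moment_deriv (r m : nat) (y : R) : R :=
  match r with
  | O => match m with O => erfint y - erfint_lim | S m' => gauss m' y end
  | S O => - (1 / 2) * gauss m y
  | S (S r') =>
      ((INR r' - INR m + 1) * moment_deriv r' m y - y * moment_deriv r' (S m) y) / 2
  end.

Lemma moment_deriv_SS (r m : nat) (y : R) :
  moment_deriv (S (S r)) m y =
  ((INR r - INR m + 1) * moment_deriv r m y - y * moment_deriv r (S m) y) / 2.
Proof. reflexivity. Qed.

Lemma is_derive_moment_deriv (r m : nat) (y : R) :
  is_derive (moment_deriv r m) y (moment_deriv r (S m) y).
Proof.
  revert m y. induction r as [| |r IH _] using nat_ind2; intros m y.
  - destruct m as [|m]; [|apply is_derive_gauss].
    simpl moment_deriv. evar_last.
    + apply (is_derive_minus erfint (fun _ => erfint_lim));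
        [apply is_derive_erfint|apply is_derive_const].
    + unfold minus, plus, opp, zero; simpl. R_eq; ring.
  - apply (is_derive_scal (gauss m)), is_derive_gauss.
  - rewrite moment_deriv_SS.
    apply (is_derive_ext (fun y => - (1 / 2) * (y * moment_deriv r (S m) y) +
      ((INR r - INR m + 1) / 2) * moment_deriv r m y)).
    { intros t. rewrite moment_deriv_SS. R_eq. field. }
    evar_last; [apply is_derive_affine_comb; apply IH|].
    rewrite S_INR. R_eq. field.
Qed.

(** Only derivatives of positive order: the antiderivative tends to 0 at plus infinity, but for even
    r not at minus infinity. *)
Lemma rapid_moment_deriv (r m : nat) : rapid (moment_deriv r (S m)).
Proof.
  revert m. induction r as [| |r IH _] using nat_ind2; intros m.
  - apply rapid_gauss.
  - apply rapid_scal, rapid_gauss.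
  - eapply rapid_ext; [|apply rapid_plus;
      [apply (rapid_scal ((INR r - INR (S m) + 1) / 2)), (IH m)|
       apply (rapid_scal (- (1 / 2))), rapid_mult_id, (IH (S m))]].
    intros y; rewrite moment_deriv_SS. field.
Qed.

Lemma is_lim_rapid (f : R -> R) : rapid f -> is_lim f p_infty 0.
Proof.
  intros Hf. destruct (Hf 1%nat) as [C HC]. apply is_lim_spec. intros eps.
  exists (Rmax 1 (C / eps)). intros y Hy. rewrite Rminus_0_r.
  pose proof (Rmax_l 1 (C / eps)). pose proof (Rmax_r 1 (C / eps)).
  specialize (HC y). rewrite pow_1, (Rabs_pos_eq y) in HC by lra.
  apply (Rmult_lt_reg_l y); [lra|]. apply Rle_lt_trans with C; [exact HC|].
  apply Rle_lt_trans with (C / eps * eps).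
  - right; field. apply Rgt_not_eq, cond_pos.
  - apply Rmult_lt_compat_r; [apply cond_pos|lra].
Qed.

Lemma is_lim_moment_deriv (r m : nat) : is_lim (moment_deriv r m) p_infty 0.
Proof.
  destruct m as [|m]; [|apply is_lim_rapid, rapid_moment_deriv].
  induction r as [| |r IH _] using nat_ind2.
  - simpl. apply (is_lim_le_le_loc (fun y => - exp (1 - y)) (fun _ => 0)).
    + exists 0. intros y _. pose proof (erfint_lim_tail y). lra.
    + evar_last.
      * apply is_lim_opp, (is_lim_comp exp (fun y => 1 - y) p_infty 0 m_infty).
        -- apply is_lim_exp_m.
        -- apply is_lim_spec. intros M. exists (1 - M). intros; lra.
        -- exists 0. intros; discriminate.
      * simpl. f_equal. ring.
    + apply is_lim_const.
  - apply is_lim_rapid, rapid_scal, rapid_gauss.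
  - apply (is_lim_ext (fun y => (INR r - INR 0 + 1) / 2 * moment_deriv r 0 y +
      - (1 / 2) * (y * moment_deriv r 1 y))).
    { intros y. rewrite moment_deriv_SS. field. }
    evar_last.
    + apply is_lim_plus'; [apply (is_lim_scal_l _ ((INR r - INR 0 + 1) / 2) _ 0), IH|].
      apply is_lim_rapid, rapid_scal, rapid_mult_id, rapid_moment_deriv.
    + simpl. f_equal. ring.
Qed.

(** The recursion at m = 1 involves order 2, which is obtained by differentiating the induction
    hypothesis. *)
Lemma moment_deriv_1 (r : nat) (y : R) : moment_deriv r 1 y = y ^ r * exp (- (y * y)).
Proof.
  revert y. induction r as [| |r IH _] using nat_ind2; intros y.
  - simpl; ring.
  - simpl; field.
  - rewrite moment_deriv_SS, IH.
    replace (moment_deriv r 2 y) with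
      (INR r * y ^ pred r * exp (- (y * y)) - 2 * (y * (y ^ r * exp (- (y * y))))).
    + simpl (INR 1). destruct r as [|r]; simpl; field.
    + rewrite <- (is_derive_unique _ _ _ (is_derive_moment_deriv r 1 y)).
      rewrite (Derive_ext _ _ _ IH). symmetry. apply is_derive_unique.
      auto_derive; [auto|]. ring.
Qed.

Lemma moment_deriv_at_0 (r m : nat) :
  moment_deriv (S (S r)) m 0 = (INR r - INR m + 1) / 2 * moment_deriv r m 0.
Proof. rewrite moment_deriv_SS. field. Qed.

Lemma gauss_opp (m : nat) (y : R) : gauss m (- y) = (-1) ^ m * gauss m y.
Proof.
  induction m as [| |m IH0 IH1] using nat_ind2.
  - simpl. replace (- y * - y) with (y * y) by ring. ring.
  - simpl. replace (- y * - y) with (y * y) by ring. ring.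
  - rewrite !gauss_SS, IH0, IH1. simpl. ring.
Qed.

(** This is a derivative of odd order of the even function y^(2i) exp(- y^2). *)
Lemma moment_deriv_even_0 (i m : nat) : moment_deriv (2 * i) (2 * S m) 0 = 0.
Proof.
  induction i as [|i IH].
  - replace (2 * S m)%nat with (S (2 * m + 1)) by lia.
    change (gauss (2 * m + 1) 0 = 0).
    pose proof (gauss_opp (2 * m + 1) 0) as E.
    rewrite Ropp_0, pow_add, pow_mult in E.
    replace ((-1) ^ 2) with 1 in E by ring. rewrite pow1 in E. lra.
  - replace (2 * S i)%nat with (S (S (2 * i))) by lia.
    rewrite moment_deriv_at_0, IH. ring.
Qed.

(** Since the antiderivative is normalised at infinity, it is odd only up to its value at 0. The two
    claims are proved together because the recursion mixes neighbouring orders. *)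
Lemma moment_deriv_parity (i m : nat) (y : R) :
  moment_deriv (2 * i) (2 * m + 1) (- y) = moment_deriv (2 * i) (2 * m + 1) y /\
  moment_deriv (2 * i) (2 * m) y + moment_deriv (2 * i) (2 * m) (- y) =
  2 * moment_deriv (2 * i) (2 * m) 0.
Proof.
  assert (Hpow : forall k, (-1) ^ (2 * k) = 1).
  { intros k. rewrite pow_mult. replace ((-1) ^ 2) with 1 by ring. apply pow1. }
  revert m y. induction i as [|i IH]; intros m y.
  - change (2 * 0)%nat with 0%nat. split.
    1: rewrite Nat.add_1_r.
    + change (gauss (2 * m) (- y) = gauss (2 * m) y). rewrite gauss_opp, Hpow. ring.
    + destruct m as [|m].
      * simpl.
        destruct (is_derive_MVT (fun y => erfint y + erfint (- y))
          (fun y => gauss 0 y + - gauss 0 (- y)) 0 y) as (c & _ & E).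
        -- intros x. apply (is_derive_plus erfint (fun y => erfint (- y))).
           ++ apply is_derive_erfint.
           ++ evar_last; [apply (is_derive_comp erfint Ropp)|].
              ** apply is_derive_erfint.
              ** instantiate (1 := - 1). auto_derive; [auto|]. R_eq; ring.
              ** unfold scal, opp, one, mult; simpl. unfold mult; simpl. R_eq; ring.
        -- rewrite (gauss_opp 0), Ropp_0 in E. simpl in E. lra.
      * replace (2 * S m)%nat with (S (2 * m + 1)) by lia.
        change (gauss (2 * m + 1) y + gauss (2 * m + 1) (- y) = 2 * gauss (2 * m + 1) 0).
        rewrite gauss_opp, pow_add, Hpow.
        assert (E : gauss (2 * m + 1) 0 = 0).
        { pose proof (gauss_opp (2 * m + 1) 0) as E.
          rewrite Ropp_0, pow_add, Hpow in E. lra. }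
        rewrite E. ring.
  - replace (2 * S i)%nat with (S (S (2 * i))) by lia.
    rewrite !moment_deriv_SS. rewrite !Nat.add_1_r. split.
    + destruct (IH m y) as [H1 _]. rewrite Nat.add_1_r in H1. rewrite H1.
      destruct (IH (S m) y) as [_ H2].
      replace (2 * S m)%nat with (S (S (2 * m))) in H2 by lia.
      assert (HZ : moment_deriv (2 * i) (S (S (2 * m))) 0 = 0).
      { replace (S (S (2 * m))) with (2 * S m)%nat by lia. apply moment_deriv_even_0. }
      rewrite HZ in H2.
      replace (moment_deriv (2 * i) (S (S (2 * m))) (- y)) with
        (- moment_deriv (2 * i) (S (S (2 * m))) y) by lra. field.
    + destruct (IH m y) as [H1 H2]. rewrite Nat.add_1_r in H1. rewrite H1.
      match goal with |- ?A = ?B => transitivity (((INR (2 * i) - INR (2 * m) + 1) *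
        (moment_deriv (2 * i) (2 * m) y + moment_deriv (2 * i) (2 * m) (- y))) / 2) end;
      [field|rewrite H2; field].
Qed.

(** * Gamma at the positive multiples of 1/2 *)

Lemma filter_prod_pos (Q : R -> Prop) : (forall x, 0 < x -> Q x) ->
  filter_prod (at_right 0) (Rbar_locally p_infty)
    (fun ab => forall x, Rmin (fst ab) (snd ab) <= x <= Rmax (fst ab) (snd ab) -> Q x).
Proof.
  intros HQ. apply (Filter_prod _ _ _ (fun a => 0 < a) (fun b => 0 < b)).
  - exists (mkposreal 1 Rlt_0_1). intros; assumption.
  - exists 0. auto.
  - intros a b Ha Hb x Hx. apply HQ. simpl in Hx.
    eapply Rlt_le_trans; [|apply Hx]. apply Rmin_glb_lt; assumption.
Qed.

(* Substituting t = y^2 in the integral defining Gamma. *)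
Lemma Gamma_moment_deriv (r : nat) :
  Gamma ((INR r + 1) / 2) = - 2 * moment_deriv r 0 0.
Proof.
  (* An antiderivative of the integrand on t > 0: the chain rule supplies the division by sqrt t. It
     tends to 0 at infinity and is continuous at 0. *)
  set (f := fun t => 2 * moment_deriv r 0 (sqrt t)).
  set (df := fun t => moment_deriv r 1 (sqrt t) / sqrt t).
  assert (Hf : forall t, 0 < t -> is_derive f t (df t)).
  { intros t Ht. assert (Hs : 0 < sqrt t) by (apply sqrt_lt_R0, Ht).
    evar_last.
    - apply is_derive_scal, (is_derive_comp (moment_deriv r 0) sqrt).
      + apply is_derive_moment_deriv.
      + apply is_derive_sqrt; [apply is_derive_id|exact Ht].
    - unfold df, scal, one; simpl. unfold mult; simpl. R_eq. field. lra. }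
  assert (Hdf : forall t, 0 < t -> continuous df t).
  { intros t Ht. apply (ex_derive_continuous df). unfold df.
    assert (Hs : 0 < sqrt t) by (apply sqrt_lt_R0, Ht).
    apply (ex_derive_ext (fun t => sqrt t ^ r * exp (- (sqrt t * sqrt t)) / sqrt t)).
    { intros x; rewrite moment_deriv_1; reflexivity. }
    auto_derive. repeat split; auto; lra. }
  unfold Gamma. apply is_RInt_gen_unique.
  apply (is_RInt_gen_ext (Derive f)).
  - eapply filter_imp; [|apply (filter_prod_pos (fun t => Derive f t =
      Rpower t ((INR r + 1) / 2 - 1) * exp (- t)))].
    + intros ab H x Hx. apply H. lra.
    + intros t Ht. rewrite (is_derive_unique _ _ _ (Hf t Ht)). unfold df.
      rewrite moment_deriv_1, sqrt_sqrt by lra.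
      assert (Hs : 0 < sqrt t) by (apply sqrt_lt_R0, Ht).
      rewrite <- (Rpower_pow r (sqrt t) Hs), <- Rpower_sqrt, Rpower_mult by exact Ht.
      replace ((INR r + 1) / 2 - 1) with (/ 2 * INR r + - / 2) by field.
      rewrite Rpower_plus, Rpower_Ropp. unfold Rdiv; ring.
  - replace (- 2 * moment_deriv r 0 0) with (0 - 2 * moment_deriv r 0 0) by ring.
    apply is_RInt_gen_Derive.
    + apply filter_prod_pos. intros x Hx. eexists; apply Hf, Hx.
    + apply filter_prod_pos. intros x Hx.
      apply (continuous_ext_loc _ df); [|apply Hdf, Hx].
      exists (mkposreal x Hx). intros t Ht. symmetry. apply is_derive_unique, Hf.
      unfold ball in Ht; simpl in Ht. unfold AbsRing_ball, abs, minus, plus, opp in Ht.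
      simpl in Ht. apply Rabs_def2 in Ht. lra.
    + assert (Hc : continuous f 0).
      { unfold f. apply (continuous_scal_r 2 (fun t => moment_deriv r 0 (sqrt t))).
        apply continuous_comp; [apply continuous_sqrt|].
        apply (ex_derive_continuous (moment_deriv r 0)).
        eexists; apply is_derive_moment_deriv. }
      eapply filterlim_filter_le_1; [|].
      2: { unfold continuous, f in Hc. rewrite sqrt_0 in Hc. exact Hc. }
      apply filter_le_within.
    + unfold f. apply (is_lim_ext (fun t => 2 * moment_deriv r 0 (sqrt t)) f p_infty 0);
        [reflexivity|]. evar_last.
      * apply (is_lim_scal_l (fun t => moment_deriv r 0 (sqrt t)) 2 p_infty 0).
        apply (is_lim_comp (moment_deriv r 0) sqrt p_infty 0 p_infty).
        -- apply is_lim_moment_deriv.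
        -- apply is_lim_sqrt_p, is_lim_id.
        -- exists 0. intros; discriminate.
      * simpl. f_equal. ring.
Qed.

Lemma Gamma_succ (r : nat) :
  Gamma ((INR r + 1) / 2 + 1) = (INR r + 1) / 2 * Gamma ((INR r + 1) / 2).
Proof.
  replace ((INR r + 1) / 2 + 1) with ((INR (S (S r)) + 1) / 2) by (rewrite !S_INR; field).
  rewrite !Gamma_moment_deriv, moment_deriv_at_0. simpl. field.
Qed.

(** * Euler-Maclaurin summation *)

Lemma sum_rev (f : nat -> R) (n : nat) :
  sum_f_R0 f n = sum_f_R0 (fun k => f (n - k)%nat) n.
Proof.
  revert f. induction n as [|n IH]; intros f; [reflexivity|].
  rewrite sum_head, tech5, Nat.sub_diag, (IH (fun k => f (S k))), Rplus_comm. f_equal.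
  apply sum_eq; intros k Hk. f_equal. lia.
Qed.

Lemma is_derive_taylor_sum (c : nat -> R) (N : nat) (h : R) :
  is_derive (fun h => sum_f_R0 (fun k => c k * (h ^ k / INR (fact k))) (S N)) h
    (sum_f_R0 (fun k => c (S k) * (h ^ k / INR (fact k))) N).
Proof.
  assert (Hk : forall k, is_derive (fun h => c (S k) * (h ^ S k / INR (fact (S k)))) h
    (c (S k) * (h ^ k / INR (fact k)))).
  { intros k. pose proof (INR_fact_pos k). pose proof (pos_INR k).
    assert (EF : INR (fact (S k)) = (INR k + 1) * INR (fact k))
      by (rewrite fact_simpl, mult_INR, S_INR; reflexivity).
    rewrite EF. set (F := INR (fact k)) in *.
    auto_derive; [auto|]. destruct k; [simpl|]; field; simpl in *; lra. }
  induction N as [|N IH].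
  - simpl. evar_last.
    + apply (is_derive_plus (fun _ => c 0%nat * (1 / 1)) (fun h => c 1%nat * (h * 1 / 1)));
        [apply is_derive_const|exact (Hk 0%nat)].
    + unfold plus, zero; simpl. R_eq; ring.
  - apply (is_derive_plus (fun h => sum_f_R0 (fun k => c k * (h ^ k / INR (fact k))) (S N)));
      [exact IH|apply Hk].
Qed.

(** The remainder, differentiated in h, is the remainder of one order less for the family shifted by
    one; the mean value theorem then gives one more factor |h|. The factorial in the usual bound is
    given away. *)
Lemma taylor_bound (n : nat) : forall (G : nat -> R -> R) (a H M : R),
  (forall m y, is_derive (G m) y (G (S m) y)) ->
  (forall y, Rabs (y - a) <= H -> Rabs (G (S n) y) <= M) ->
  forall h, Rabs h <= H ->
  Rabs (G 0%nat (a + h) - sum_f_R0 (fun k => G k a * (h ^ k / INR (fact k))) n) <=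
  M * Rabs h ^ S n.
Proof.
  induction n as [|n IH]; intros G a H M HG HM h Hh.
  - simpl. destruct (is_derive_MVT (G 0%nat) (G 1%nat) a (a + h) (HG 0%nat)) as (c & Hc & E).
    replace (G 0%nat (a + h) - G 0%nat a * (1 / 1)) with (G 1%nat c * h) by lra.
    rewrite Rabs_mult, Rmult_1_r. apply Rmult_le_compat_r; [apply Rabs_pos|].
    apply HM. eapply Rle_trans; [|exact Hh]. revert Hc.
    unfold Rmin, Rmax, Rabs. repeat destruct Rle_dec; repeat destruct Rcase_abs; lra.
  - set (f := fun h => G 0%nat (a + h) -
      sum_f_R0 (fun k => G k a * (h ^ k / INR (fact k))) (S n)).
    destruct (is_derive_MVT f (fun h => G 1%nat (a + h) -
      sum_f_R0 (fun k => G (S k) a * (h ^ k / INR (fact k))) n) 0 h) as (c & Hc & E).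
    + intros x. apply (is_derive_minus (fun h => G 0%nat (a + h)));
        [|apply (is_derive_taylor_sum (fun k => G k a))].
      evar_last.
      * apply (is_derive_comp (G 0%nat) (fun h => a + h)); [apply HG|].
        auto_derive; auto.
      * unfold scal; simpl. unfold mult; simpl. R_eq; ring.
    + assert (Ef0 : f 0 = 0).
      { unfold f. rewrite sum_head, sum_zero.
        - rewrite Rplus_0_r. simpl. field.
        - intros k _. rewrite pow_i by lia. unfold Rdiv; ring. }
      change (Rabs (f h) <= M * Rabs h ^ S (S n)).
      replace (f h) with ((G 1%nat (a + c) -
        sum_f_R0 (fun k => G (S k) a * (c ^ k / INR (fact k))) n) * h) by lra.
      assert (Hch : Rabs c <= Rabs h).
      { revert Hc. unfold Rmin, Rmax, Rabs.
        repeat destruct Rle_dec; repeat destruct Rcase_abs; lra. }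
      assert (HM0 : 0 <= M).
      { eapply Rle_trans; [apply Rabs_pos|apply (HM a)].
        rewrite Rminus_diag, Rabs_R0. eapply Rle_trans; [apply Rabs_pos|exact Hh]. }
      rewrite Rabs_mult. change (Rabs h ^ S (S n)) with (Rabs h * Rabs h ^ S n).
      rewrite (Rmult_comm (Rabs h)), <- Rmult_assoc.
      apply Rmult_le_compat_r; [apply Rabs_pos|].
      eapply Rle_trans.
      * apply (IH (fun m => G (S m)) a H M); [intros; apply HG|exact HM|lra].
      * apply Rmult_le_compat_l; [exact HM0|]. apply pow_incr.
        split; [apply Rabs_pos|exact Hch].
Qed.

(** Taylor expansions from the midpoint to both ends of a cell of width u: even orders cancel, and
    odd ones carry 2 (u/2)^(2i+1) / (2i+1)! = sinhc i * u^(2i+1). *)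
Lemma cell_bound (G : nat -> R -> R) (I m : nat) (a u M : R) :
  0 < u -> (forall m y, is_derive (G m) y (G (S m) y)) ->
  (forall y, Rabs (y - a) <= u / 2 -> Rabs (G (m + (2 * I + 2))%nat y) <= M) ->
  Rabs (G m (a + u / 2) - G m (a - u / 2) -
    sum_f_R0 (fun i => sinhc i * u ^ (2 * i + 1) * G (m + (2 * i + 1))%nat a) I) <=
  2 * M * u ^ (2 * I + 2).
Proof.
  intros Hu HG HM.
  assert (HT : forall h, Rabs h = u / 2 ->
    Rabs (G m (a + h) - sum_f_R0 (fun k => G (m + k)%nat a * (h ^ k / INR (fact k)))
      (2 * I + 1)) <= M * u ^ (2 * I + 2)).
  { intros h Hh.
    assert (HM0 : 0 <= M).
    { eapply Rle_trans; [apply Rabs_pos|apply (HM a)]. rewrite Rminus_diag, Rabs_R0. lra. }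
    eapply Rle_trans.
    - pose proof (taylor_bound (2 * I + 1) (fun k => G (m + k)%nat) a (u / 2) M) as T.
      cbv beta in T. rewrite Nat.add_0_r in T. apply T; [|  |lra].
      + intros k y. rewrite Nat.add_succ_r. apply HG.
      + intros y Hy. replace (S (2 * I + 1)) with (2 * I + 2)%nat by lia. auto.
    - replace (S (2 * I + 1)) with (2 * I + 2)%nat by lia.
      apply Rmult_le_compat_l; [exact HM0|]. apply pow_incr. lra. }
  pose proof (HT (u / 2)) as H1. pose proof (HT (- (u / 2))) as H2.
  rewrite Rabs_Ropp in H2. rewrite Rabs_pos_eq in H1, H2 by lra.
  specialize (H1 eq_refl). specialize (H2 eq_refl).
  assert (ES : sum_f_R0 (fun i => sinhc i * u ^ (2 * i + 1) * G (m + (2 * i + 1))%nat a) I =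
    sum_f_R0 (fun k => G (m + k)%nat a * ((u / 2) ^ k / INR (fact k))) (2 * I + 1) -
    sum_f_R0 (fun k => G (m + k)%nat a * ((- (u / 2)) ^ k / INR (fact k))) (2 * I + 1)).
  { rewrite sum_sub, sum_odd.
    - apply sum_eq; intros i Hi. unfold sinhc.
      rewrite !pow_add, !pow_mult.
      replace ((- (u / 2)) ^ 2) with (u ^ 2 * / 4) by field.
      replace ((u / 2) ^ 2) with (u ^ 2 * / 4) by field.
      rewrite Rpow_mult_distr, pow_inv.
      field. split; [apply pow_nonzero; lra|apply INR_fact_neq_0].
    - intros i. rewrite !pow_mult.
      replace ((- (u / 2)) ^ 2) with ((u / 2) ^ 2) by ring. ring. }
  rewrite ES. replace (a - u / 2) with (a + - (u / 2)) by ring.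
  set (S1 := sum_f_R0 _ _) in *. set (S2 := sum_f_R0 (fun k => _ * ((- (u / 2)) ^ k / _)) _) in *.
  replace (G m (a + u / 2) - G m (a + - (u / 2)) - (S1 - S2)) with
    ((G m (a + u / 2) - S1) - (G m (a + - (u / 2)) - S2)) by ring.
  unfold Rminus at 1. eapply Rle_trans; [apply Rabs_triang|].
  rewrite Rabs_Ropp. lra.
Qed.

(** * Summation over a grid of cells *)

Definition recip_diff (k : nat) : R := / (INR k + 1) - / (INR k + 2).

(** Amounts to k + 2 <= 2 (k + 1); the telescoping right side is the summable majorant for all grid
    sums. *)
Lemma recip_diff_ge (k : nat) : 0 < (INR k + 1) ^ 2 /\ / (INR k + 1) ^ 2 <= 2 * recip_diff k.
Proof.
  pose proof (pos_INR k) as Hk. split; [nra|]. unfold recip_diff.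
  apply (Rmult_le_reg_r ((INR k + 1) ^ 2 * (INR k + 2))); [nra|].
  replace (/ (INR k + 1) ^ 2 * ((INR k + 1) ^ 2 * (INR k + 2))) with (INR k + 2)
    by (field; lra).
  replace (2 * (/ (INR k + 1) - / (INR k + 2)) * ((INR k + 1) ^ 2 * (INR k + 2))) with
    (2 * (INR k + 1)) by (field; lra). lra.
Qed.

Lemma is_series_telescope (f : nat -> R) (b : nat -> R) (l : R) :
  (forall K, sum_f_R0 f K = b K - l) -> is_lim_seq b 0 -> is_series f (- l).
Proof.
  intros E Hb. change (is_lim_seq (sum_n f) (- l)).
  apply (is_lim_seq_ext (fun K => b K - l)).
  - intros K. rewrite sum_n_Reals. symmetry. apply E.
  - evar_last; [apply is_lim_seq_minus'; [exact Hb|apply is_lim_seq_const]|].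
    f_equal; ring.
Qed.

Lemma is_lim_seq_INR_shift (a : R) : is_lim_seq (fun k => INR k + a) p_infty.
Proof.
  apply (is_lim_seq_plus _ _ p_infty a);
    [apply is_lim_seq_INR|apply is_lim_seq_const|reflexivity].
Qed.

Lemma ex_series_recip_diff : ex_series recip_diff.
Proof.
  exists (- - 1). apply (is_series_telescope recip_diff (fun K => - / (INR K + 2))).
  - intros K. induction K as [|K IH]; [unfold recip_diff; simpl; field|].
    rewrite tech5, IH, S_INR. unfold recip_diff. rewrite S_INR.
    pose proof (pos_INR K). field. lra.
  - evar_last; [apply (proj1 (is_lim_seq_opp (fun K => / (INR K + 2)) 0)),
      (is_lim_seq_inv (fun K => INR K + 2) p_infty)|].
    + apply is_lim_seq_INR_shift.
    + discriminate.
    + simpl. f_equal; ring.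
Qed.

Lemma is_series_sum (a : nat -> nat -> R) (l : nat -> R) (N : nat) :
  (forall i, (i <= N)%nat -> is_series (a i) (l i)) ->
  is_series (fun k => sum_f_R0 (fun i => a i k) N) (sum_f_R0 l N).
Proof.
  induction N as [|N IH]; intros H; simpl.
  - apply H; lia.
  - apply (is_series_plus (fun k => sum_f_R0 (fun i => a i k) N) (a (S N)));
      [apply IH; intros; apply H; lia|apply H; lia].
Qed.

(* The points [k + delta] carry weights [w k] for which the midpoint sums of
   the derivatives of even order telescope exactly. *)
Definition grid (r : nat) (w : nat -> R) (delta : R) : Prop :=
  0 <= delta <= 1 / 2 /\ (forall k, 0 <= w k <= 1) /\
  forall m u K,
    sum_f_R0 (fun k => w k * (moment_deriv r (2 * m) (u * (INR k + delta) + u / 2) -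
      moment_deriv r (2 * m) (u * (INR k + delta) - u / 2))) K =
    moment_deriv r (2 * m) (u * (INR K + delta) + u / 2) - moment_deriv r (2 * m) 0.

(** The cell around 0 is symmetric, and by parity half of its increment is the value at u/2 minus
    the one at 0. Hence the weight 1/2 and the even power. *)
Lemma grid_integers (i : nat) :
  grid (2 * i) (fun k => match k with O => 1 / 2 | _ => 1 end) 0.
Proof.
  split; [lra|split].
  - intros [|k]; lra.
  - intros m u K. induction K as [|K IH].
    + destruct (moment_deriv_parity i m (u / 2)) as [_ E]. cbn [sum_f_R0]. change (INR 0) with 0.
      replace (u * (0 + 0) + u / 2) with (u / 2) by ring.
      replace (u * (0 + 0) - u / 2) with (- (u / 2)) by ring. lra.
    + rewrite tech5, IH, S_INR.
      replace (u * (INR K + 1 + 0) - u / 2) with (u * (INR K + 0) + u / 2) by field. ring.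
Qed.

(** Here the cells tile the half-line starting exactly at 0. *)
Lemma grid_half_integers (r : nat) : grid r (fun _ => 1) (1 / 2).
Proof.
  split; [lra|split].
  - intros; lra.
  - intros m u K. induction K as [|K IH].
    + cbn [sum_f_R0]. change (INR 0) with 0.
      replace (u * (0 + 1 / 2) - u / 2) with 0 by field. ring.
    + rewrite tech5, IH, S_INR.
      replace (u * (INR K + 1 + 1 / 2) - u / 2) with (u * (INR K + 1 / 2) + u / 2) by field.
      ring.
Qed.

(** In the k-th cell (k + 1)^2 u^2 <= 16 (1 + y^2), and rapid decay bounds (1 + y^2) |f(y)|. The
    constant 32 is this 16 times the 2 of [recip_diff_ge]. *)
Lemma grid_decay (r q : nat) : exists C, 0 <= C /\ forall delta u k y,
  0 <= delta <= 1 / 2 -> 0 < u <= 1 ->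
  Rabs (y - u * (INR k + delta)) <= u / 2 ->
  Rabs (moment_deriv r (S q) y) <= C / u ^ 2 * recip_diff k.
Proof.
  destruct (rapid_moment_deriv r q 0%nat) as [C0 H0], (rapid_moment_deriv r q 2%nat) as [C2 H2].
  set (f := moment_deriv r (S q)) in *.
  assert (HC0 : 0 <= C0).
  { eapply Rle_trans; [|apply (H0 0)]. simpl. rewrite Rmult_1_l. apply Rabs_pos. }
  assert (HC2 : 0 <= C2).
  { eapply Rle_trans; [|apply (H2 0)]. apply Rmult_le_pos; [apply pow_le|]; apply Rabs_pos. }
  exists (32 * (C0 + C2)). split; [lra|]. intros delta u k y Hd Hu Hy.
  destruct (recip_diff_ge k) as [Hk1 Hk2].
  specialize (H0 y). specialize (H2 y). rewrite pow_O in H0.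
  rewrite pow2_abs in H2.
  assert (Hy2 : (INR k + 1) ^ 2 * u ^ 2 <= 16 * (1 + y ^ 2)).
  { destruct k as [|k].
    - simpl (INR 0). nra.
    - rewrite S_INR in *. pose proof (pos_INR k).
      assert (u * (INR k + 2) / 4 <= y).
      { apply Rabs_le_between in Hy. nra. }
      assert (0 <= u * (INR k + 2) / 4) by nra. nra. }
  assert (Hf : (1 + y ^ 2) * Rabs (f y) <= C0 + C2) by (rewrite Rmult_plus_distr_r; lra).
  pose proof (Rabs_pos (f y)) as Hp.
  apply Rle_trans with ((16 * (C0 + C2)) / u ^ 2 * / (INR k + 1) ^ 2).
  - apply (Rmult_le_reg_l ((INR k + 1) ^ 2 * u ^ 2)); [apply Rmult_lt_0_compat; nra|].
    replace ((INR k + 1) ^ 2 * u ^ 2 * (16 * (C0 + C2) / u ^ 2 * / (INR k + 1) ^ 2)) with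
      (16 * (C0 + C2)) by (field; split; [pose proof (pos_INR k)|]; lra).
    apply Rle_trans with (16 * ((1 + y ^ 2) * Rabs (f y))); [nra|lra].
  - replace (32 * (C0 + C2) / u ^ 2 * recip_diff k) with
      (16 * (C0 + C2) / u ^ 2 * (2 * recip_diff k))
      by (field; lra).
    apply Rmult_le_compat_l; [|exact Hk2].
    apply Rdiv_le_0_compat; nra.
Qed.

Definition grid_sum (r : nat) (w : nat -> R) (delta : R) (q : nat) (u : R) : R :=
  Series (fun k => w k * moment_deriv r q (u * (INR k + delta))).

Lemma Series_abs_le (a b : nat -> R) (l : R) :
  is_series a l -> ex_series b -> (forall k, Rabs (a k) <= b k) -> Rabs l <= Series b.
Proof.
  intros Ha Hb H. rewrite <- (is_series_unique _ _ Ha).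
  eapply Rle_trans; [apply Series_Rabs|].
  - apply (ex_series_le (fun k => Rabs (a k)) b); [|exact Hb].
    intros n. unfold norm; simpl. unfold abs; simpl. rewrite Rabs_Rabsolu. apply H.
  - apply Series_le; [|exact Hb]. intros; split; [apply Rabs_pos|apply H].
Qed.

Lemma is_series_grid_sum (r : nat) (w : nat -> R) (delta : R) (q : nat) (u : R) :
  grid r w delta -> 0 < u <= 1 ->
  is_series (fun k => w k * moment_deriv r (S q) (u * (INR k + delta)))
    (grid_sum r w delta (S q) u).
Proof.
  intros (Hd & Hw & _) Hu. apply Series_correct.
  destruct (grid_decay r q) as (C & HC & H).
  apply (ex_series_le (fun k => w k * moment_deriv r (S q) (u * (INR k + delta)))
    (fun k => C / u ^ 2 * recip_diff k)).
  - intros k. unfold norm; simpl. unfold abs; simpl. rewrite Rabs_mult.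
    rewrite (Rabs_pos_eq (w k)) by apply Hw.
    specialize (H delta u k (u * (INR k + delta)) Hd Hu).
    rewrite Rminus_diag, Rabs_R0 in H. specialize (H ltac:(lra)).
    eapply Rle_trans; [|exact H]. rewrite <- (Rmult_1_l (Rabs (moment_deriv _ _ _))) at 2.
    apply Rmult_le_compat_r; [apply Rabs_pos|apply Hw].
  - apply (ex_series_scal_l (C / u ^ 2) recip_diff), ex_series_recip_diff.
Qed.

(** Sum the cell expansions over k. The increments telescope, and the errors of order u^(2I+2) lose
    u^2 to the number of cells in [grid_decay]. *)
Lemma grid_sum_rel (r : nat) (w : nat -> R) (delta : R) (m I : nat) :
  grid r w delta -> exists D, forall u, 0 < u <= 1 ->
  Rabs (- moment_deriv r (2 * m) 0 -
    sum_f_R0 (fun i => sinhc i * u ^ (2 * i + 1) *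
      grid_sum r w delta (2 * m + (2 * i + 1)) u) I) <= D * u ^ (2 * I).
Proof.
  intros HG. destruct (grid_decay r (2 * m + (2 * I + 1))) as (C & HC & HB).
  exists (2 * C * Series recip_diff). intros u Hu.
  set (b := fun k => 2 * C * u ^ (2 * I) * recip_diff k).
  assert (Hbs : ex_series b)
    by apply (ex_series_scal_l (2 * C * u ^ (2 * I)) recip_diff), ex_series_recip_diff.
  replace (2 * C * Series recip_diff * u ^ (2 * I)) with (Series b).
  2: { unfold b. rewrite Series_scal_l. ring. }
  eapply (Series_abs_le (fun k =>
    w k * (moment_deriv r (2 * m) (u * (INR k + delta) + u / 2) -
      moment_deriv r (2 * m) (u * (INR k + delta) - u / 2)) -
    sum_f_R0 (fun i => sinhc i * u ^ (2 * i + 1) *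
      (w k * moment_deriv r (2 * m + (2 * i + 1)) (u * (INR k + delta)))) I));
    [|exact Hbs|].
  - apply (is_series_minus (fun k => w k * (_ - _)) (fun k => sum_f_R0 _ I)).
    + destruct HG as (Hd & Hw & HT).
      apply (is_series_telescope _ _ _ (HT m u)).
      apply (is_lim_comp_seq (moment_deriv r (2 * m))
        (fun k => u * (INR k + delta) + u / 2) p_infty 0).
      * apply is_lim_moment_deriv.
      * exists 0%nat. intros; discriminate.
      * apply (is_lim_seq_ext (fun k => u * (INR k + (delta + / 2)))); [intros; field|].
        evar_last; [apply is_lim_seq_scal_l, is_lim_seq_INR_shift|].
        simpl. destruct Rle_dec; [destruct Rle_lt_or_eq_dec; [reflexivity|lra]|lra].
    + apply (is_series_sum (fun i k => sinhc i * u ^ (2 * i + 1) *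
        (w k * moment_deriv r (2 * m + (2 * i + 1)) (u * (INR k + delta))))
        (fun i => sinhc i * u ^ (2 * i + 1) * grid_sum r w delta (2 * m + (2 * i + 1)) u)).
      intros i Hi.
      apply (is_series_scal_l (sinhc i * u ^ (2 * i + 1))
        (fun k => w k * moment_deriv r (2 * m + (2 * i + 1)) (u * (INR k + delta)))
        (grid_sum r w delta (2 * m + (2 * i + 1)) u)).
      replace (2 * m + (2 * i + 1))%nat with (S (2 * m + 2 * i)) by lia.
      apply is_series_grid_sum; assumption.
  - intros k. destruct HG as (Hd & Hw & _).
    replace (w k * _ - _) with (w k *
      (moment_deriv r (2 * m) (u * (INR k + delta) + u / 2) -
       moment_deriv r (2 * m) (u * (INR k + delta) - u / 2) -
       sum_f_R0 (fun i => sinhc i * u ^ (2 * i + 1) *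
         moment_deriv r (2 * m + (2 * i + 1)) (u * (INR k + delta))) I)).
    2: { rewrite Rmult_minus_distr_l, sum_mult_l. f_equal. apply sum_eq; intros; ring. }
    rewrite Rabs_mult, (Rabs_pos_eq (w k)) by apply Hw.
    pose proof (Hw k) as Hwk.
    assert (HE := cell_bound (moment_deriv r) I (2 * m) (u * (INR k + delta)) u
      (C / u ^ 2 * recip_diff k) (proj1 Hu) (is_derive_moment_deriv r)).
    replace (2 * m + (2 * I + 2))%nat with (S (2 * m + (2 * I + 1))) in HE by lia.
    specialize (HE (fun y Hy => HB delta u k y Hd Hu Hy)).
    replace (2 * (C / u ^ 2 * recip_diff k) * u ^ (2 * I + 2)) with (b k) in HE.
    2: { unfold b. rewrite pow_add. field. lra. }
    pose proof (Rabs_pos (moment_deriv r (2 * m) (u * (INR k + delta) + u / 2) -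
       moment_deriv r (2 * m) (u * (INR k + delta) - u / 2) -
       sum_f_R0 (fun i => sinhc i * u ^ (2 * i + 1) *
         moment_deriv r (2 * m + (2 * i + 1)) (u * (INR k + delta))) I)).
    nra.
Qed.

(** Expansion in even powers of u, where t = u^2. The allowed error has the order of the last term
    kept; as N is arbitrary, passing to N + 1 recovers the usual strength. *)
Definition asymp (F : R -> R) (c : nat -> R) : Prop :=
  forall N, exists D, forall u, 0 < u <= 1 ->
    Rabs (F u - sum_f_R0 (fun n => c n * u ^ (2 * n)) N) <= D * u ^ (2 * N).

Lemma choose_bound (P : nat -> R -> Prop) (N : nat) :
  (forall m, (m <= N)%nat -> exists D, P m D) ->
  exists D : nat -> R, forall m, (m <= N)%nat -> P m (D m).
Proof.
  induction N as [|N IH]; intros H.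
  - destruct (H 0%nat (Nat.le_refl _)) as [D HD]. exists (fun _ => D).
    intros m Hm. replace m with 0%nat by lia. exact HD.
  - destruct IH as [D HD]; [intros; apply H; lia|].
    destruct (H (S N) (Nat.le_refl _)) as [D' HD'].
    exists (fun m => if Nat.eq_dec m (S N) then D' else D m).
    intros m Hm. destruct (Nat.eq_dec m (S N)) as [->|]; [exact HD'|apply HD; lia].
Qed.

(** Euler-Maclaurin summation: weight the relation of order 2m by [spow m (-1)] u^(2m) and add over
    m. By [spow_inv] all grid sums cancel except that of the first derivative. *)
Lemma asymp_grid_sum (r : nat) (w : nat -> R) (delta : R) :
  grid r w delta ->
  asymp (fun u => u * grid_sum r w delta 1 u)
    (fun n => - spow n (-1) * moment_deriv r (2 * n) 0).
Proof.
  intros HG N.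
  (* The relation for m is cut at N - m, so that after weighting every error is of order u^(2N). *)
  destruct (choose_bound _ N (fun m _ => grid_sum_rel r w delta m (N - m) HG)) as [D HD].
  exists (sum_f_R0 (fun m => Rabs (spow m (-1)) * D m) N). intros u Hu.
  set (Y := fun l => u ^ (2 * l + 1) * grid_sum r w delta (2 * l + 1) u).
  assert (EY : sum_f_R0 (fun m => sum_f_R0 (fun i =>
    spow m (-1) * sinhc i * Y (m + i)%nat) (N - m)) N = Y 0%nat).
  { rewrite <- (sum_triangle (fun m i => spow m (-1) * sinhc i * Y (m + i)%nat) N).
    transitivity (sum_f_R0 (fun n => Y n * match n with O => 1 | _ => 0 end) N).
    - apply sum_eq; intros n Hn. rewrite <- spow_inv, sum_mult_l, sum_rev.
      apply sum_eq; intros i Hi.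
      replace (n - i + (n - (n - i)))%nat with n by lia.
      replace (n - (n - i))%nat with i by lia. ring.
    - rewrite (sum_truncate _ 0 N); [simpl; ring|lia|].
      intros [|k] Hk; [lia|ring]. }
  replace (u * grid_sum r w delta 1 u) with (Y 0%nat) by (unfold Y; simpl; ring).
  rewrite <- EY, sum_sub, sum_mult_r. apply sum_abs_le. intros m Hm.
  specialize (HD m Hm u Hu).
  replace (2 * N)%nat with (2 * m + 2 * (N - m))%nat by lia. rewrite pow_add.
  match goal with |- Rabs ?A <= _ => replace A with (- (spow m (-1) * u ^ (2 * m) *
    (- moment_deriv r (2 * m) 0 -
    sum_f_R0 (fun i => sinhc i * u ^ (2 * i + 1) *
      grid_sum r w delta (2 * m + (2 * i + 1)) u) (N - m)))) end.
  - rewrite Rabs_Ropp, !Rabs_mult, (Rabs_pos_eq (u ^ _)) by (apply pow_le; lra).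
    pose proof (Rabs_pos (spow m (-1))).
    assert (0 <= u ^ (2 * m)) by (apply pow_le; lra).
    rewrite Rmult_assoc.
    replace (Rabs (spow m (-1)) * D m * (u ^ (2 * m) * u ^ (2 * (N - m)))) with
      (Rabs (spow m (-1)) * (u ^ (2 * m) * (D m * u ^ (2 * (N - m))))) by ring.
    apply Rmult_le_compat_l; [assumption|]. apply Rmult_le_compat_l; assumption.
  - rewrite Rmult_minus_distr_l, sum_mult_l, Ropp_minus_distr. f_equal; [|ring].
    apply sum_eq; intros i Hi. unfold Y.
    replace (2 * (m + i) + 1)%nat with (2 * m + (2 * i + 1))%nat by lia.
    rewrite (pow_add u (2 * m)). ring.
Qed.

(** * Heat invariants *)

Lemma asymp_ext (F G : R -> R) (c e : nat -> R) :
  (forall u, 0 < u <= 1 -> G u = F u) -> (forall n, e n = c n) ->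
  asymp F c -> asymp G e.
Proof.
  intros EF Ec H N. destruct (H N) as [D HD]. exists D. intros u Hu.
  rewrite EF by exact Hu. erewrite sum_eq; [apply HD, Hu|].
  intros; cbv beta; rewrite Ec; reflexivity.
Qed.

Lemma asymp_linear (F G : R -> R) (c e : nat -> R) (x y : R) :
  asymp F c -> asymp G e ->
  asymp (fun u => x * F u + y * G u) (fun n => x * c n + y * e n).
Proof.
  intros HF HG N. destruct (HF N) as [D HD], (HG N) as [E HE].
  exists (Rabs x * D + Rabs y * E). intros u Hu.
  specialize (HD u Hu). specialize (HE u Hu).
  match goal with |- Rabs ?A <= _ => replace A with
    (x * (F u - sum_f_R0 (fun n => c n * u ^ (2 * n)) N) +
     y * (G u - sum_f_R0 (fun n => e n * u ^ (2 * n)) N)) end.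
  - eapply Rle_trans; [apply Rabs_triang|]. rewrite !Rabs_mult.
    pose proof (Rabs_pos x). pose proof (Rabs_pos y). nra.
  - rewrite !Rmult_minus_distr_l, !sum_mult_l.
    match goal with |- ?A - ?B + (?C - ?D) = _ =>
      transitivity (A + C - (B + D)); [ring|] end.
    rewrite sum_add. f_equal. apply sum_eq; intros; ring.
Qed.

Lemma asymp_shift (F : R -> R) (c : nat -> R) :
  asymp F c ->
  asymp (fun u => u ^ 2 * F u) (fun n => match n with O => 0 | S n' => c n' end).
Proof.
  intros H [|N].
  - destruct (H 0%nat) as [D HD]. exists (Rabs (c 0%nat) + D). intros u Hu.
    specialize (HD u Hu). simpl in *.
    replace (u * (u * 1) * F u - 0 * 1) with
      (u * u * (c 0%nat + (F u - c 0%nat * 1))) by ring.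
    rewrite Rabs_mult, (Rabs_pos_eq (u * u)) by nra.
    pose proof (Rabs_triang (c 0%nat) (F u - c 0%nat * 1)).
    apply Rle_trans with (1 * Rabs (c 0%nat + (F u - c 0%nat * 1))); [|lra].
    apply Rmult_le_compat_r; [apply Rabs_pos|nra].
  - destruct (H N) as [D HD]. exists D. intros u Hu. specialize (HD u Hu).
    rewrite sum_head.
    replace (2 * S N)%nat with (2 + 2 * N)%nat by lia. rewrite pow_add.
    match goal with |- Rabs ?A <= _ => replace A with
      (u ^ 2 * (F u - sum_f_R0 (fun n => c n * u ^ (2 * n)) N)) end.
    + rewrite Rabs_mult, (Rabs_pos_eq (u ^ 2)) by nra.
      assert (0 <= u ^ 2) by nra. nra.
    + rewrite Rmult_minus_distr_l, sum_mult_l, Rmult_0_l, Rplus_0_l. f_equal.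
      apply sum_eq; intros i _.
      replace (2 * S i)%nat with (2 + 2 * i)%nat by lia. rewrite pow_add. ring.
Qed.

(** Since lambda_k = (k + rho)^2 - rho^2, the trace is exp(t rho^2) times the sum of these terms for
    i = 0; a general i corresponds to i applications of - d/dt. *)
Definition trace_term (d i : nat) (t : R) (k : nat) : R :=
  mu k d * (INR k + rho d) ^ (2 * i) * exp (- t * (INR k + rho d) ^ 2).

(** The value of a_0. *)
Definition leading_coeff (d : nat) : R := Gamma (INR d / 2) / INR (fact (d - 1)).

(** The rising factorial is what i applications of - d/dt make of t^(n - d/2). All i are treated at
    once because the passage to d + 2 uses both i and i + 1. *)
Definition trace_expansion (d : nat) (p : nat -> R -> R) : Prop :=
  forall i,
    (forall u, 0 < u <= 1 -> ex_series (trace_term d i (u ^ 2))) /\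
    asymp (fun u => u ^ (d + 2 * i) * Series (trace_term d i (u ^ 2)))
      (fun n => leading_coeff d * p n (- (INR d / 2)) * rise (INR d / 2 - INR n) i).

Lemma moment_deriv_iter (r i m : nat) :
  moment_deriv (r + 2 * i) m 0 =
  rise ((INR r + 1 - INR m) / 2) i * moment_deriv r m 0.
Proof.
  induction i as [|i IH].
  - rewrite Nat.add_0_r. simpl. ring.
  - replace (r + 2 * S i)%nat with (S (S (r + 2 * i))) by lia.
    rewrite moment_deriv_at_0, IH, plus_INR, mult_INR. simpl. field.
Qed.

(** When the multiplicity is a weighted monomial in x = k + rho, as for d = 1 and d = 2, the trace
    is a rescaled grid sum of y^r exp(- y^2) with r = d - 1 + 2i. *)
Lemma trace_expansion_base (d : nat) (p : nat -> R -> R) (w : nat -> R) :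
  (1 <= d)%nat -> (forall i, grid (d - 1 + 2 * i) w (rho d)) ->
  (forall k, mu k d = 2 * w k * (INR k + rho d) ^ (d - 1)) ->
  (forall n, leading_coeff d * p n (- (INR d / 2)) =
    - 2 * spow n (-1) * moment_deriv (d - 1) (2 * n) 0) ->
  trace_expansion d p.
Proof.
  intros Hd HG Hmu Hp i. set (r := (d - 1 + 2 * i)%nat).
  assert (HS : forall u, 0 < u <= 1 -> is_series (trace_term d i (u ^ 2))
    (2 / u ^ r * grid_sum r w (rho d) 1 u)).
  { intros u Hu.
    apply (is_series_ext (fun k => 2 / u ^ r * (w k * moment_deriv r 1 (u * (INR k + rho d))))).
    - intros k. unfold trace_term. rewrite moment_deriv_1, Hmu, Rpow_mult_distr.
      replace (- u ^ 2 * (INR k + rho d) ^ 2) with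
        (- (u * (INR k + rho d) * (u * (INR k + rho d)))) by ring.
      unfold r at 3. rewrite (pow_add _ (d - 1)).
      R_eq. field. apply pow_nonzero; lra.
    - apply (is_series_scal_l (2 / u ^ r) (fun k => w k * moment_deriv r 1 (u * (INR k + rho d)))).
      apply is_series_grid_sum; [apply HG|exact Hu]. }
  split.
  - intros u Hu. eexists; apply HS, Hu.
  - eapply asymp_ext; [| |apply (asymp_linear _ _ _ _ 2 0 (asymp_grid_sum r w (rho d) (HG i))
      (asymp_grid_sum r w (rho d) (HG i)))].
    + intros u Hu. cbv beta. rewrite (is_series_unique _ _ (HS u Hu)).
      replace (d + 2 * i)%nat with (S r) by (unfold r; lia). simpl pow.
      field. apply pow_nonzero; lra.
    + intros n. cbv beta. rewrite Hp. unfold r. rewrite moment_deriv_iter.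
      rewrite mult_INR, minus_INR by exact Hd. simpl (INR 2). simpl (INR 1).
      replace ((INR d - 1 + 1 - (1 + 1) * INR n) / 2) with (INR d / 2 - INR n) by field. ring.
Qed.

Lemma Gamma_half (r : nat) : Gamma (INR (S r) / 2) = - 2 * moment_deriv r 0 0.
Proof. rewrite S_INR. apply Gamma_moment_deriv. Qed.

(** For n >= 1 both sides vanish: on one an odd derivative of exp(- y^2) at 0, on the other a rising
    factorial starting at 0. *)
Lemma trace_expansion_circle : trace_expansion 1 moments_circle.
Proof.
  assert (Hrho : rho 1 = 0) by (unfold rho; simpl; field).
  apply (trace_expansion_base 1 _ (fun k => match k with O => 1 / 2 | _ => 1 end)).
  - lia.
  - intros i. rewrite Hrho. apply (grid_integers i).
  - intros [|k]; [simpl; field|]. rewrite mu_succ, fact_simpl, mult_INR, Nat.add_0_r, S_INR.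
    pose proof (pos_INR k). simpl. field. split; [apply INR_fact_neq_0|lra].
  - intros [|n]; unfold leading_coeff, moments_circle; rewrite Gamma_half.
    + rewrite !spow_O. simpl. field.
    + change (1 - 1)%nat with 0%nat.
      rewrite (moment_deriv_even_0 0 n : moment_deriv 0 (2 * S n) 0 = 0), rise_head.
      simpl (INR 1). replace (- (1 / 2) + 1 / 2) with 0 by field. ring.
Qed.

Lemma trace_expansion_sphere : trace_expansion 2 moments_sphere.
Proof.
  assert (Hrho : rho 2 = 1 / 2) by (unfold rho; simpl; field).
  apply (trace_expansion_base 2 _ (fun _ => 1)).
  - lia.
  - intros i. rewrite Hrho. apply grid_half_integers.
  - intros k. rewrite Hrho. destruct k as [|k]; [simpl; field|].
    rewrite mu_succ, !Nat.add_1_r, (S_INR k).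
    simpl (fact 1). simpl (2 - 1)%nat. simpl (INR 1).
    field. apply INR_fact_neq_0.
  - intros n. unfold leading_coeff, moments_sphere. rewrite Gamma_half.
    replace (- (INR 2 / 2) + 3 / 2) with (1 / 2) by (simpl; field).
    (* At s = - d/2 = -1 the exponent 2s + 1 is -1, that of the Euler-Maclaurin coefficients. *)
    replace (2 * - (INR 2 / 2) + 1) with (-1) by (simpl; field).
    assert (Hg : gauss (2 * n) 0 = (-4) ^ n * rise (1 / 2) n).
    { induction n as [|n IH].
      - simpl. rewrite Rmult_0_l, Ropp_0, exp_0. ring.
      - replace (2 * S n)%nat with (S (S (2 * n))) by lia.
        rewrite gauss_SS, IH, mult_INR. simpl. field. }
    change (moment_deriv 1 0 0) with (- (1 / 2) * exp (- (0 * 0))).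
    change (moment_deriv (2 - 1) (2 * n) 0) with (- (1 / 2) * gauss (2 * n) 0).
    rewrite Hg, Rmult_0_l, Ropp_0, exp_0. simpl (INR _). field.
Qed.

(** The points x agree by [rho_lift], so going from d to d + 2 multiplies the weight at x by (x^2 -
    rho^2) / (d (d + 1)). *)
Lemma mu_lift (d k : nat) : (1 <= d)%nat ->
  mu k (S (S d)) =
  mu (S k) d * ((INR (S k) + rho d) ^ 2 - rho d ^ 2) / (INR d * (INR d + 1)).
Proof.
  intros Hd. destruct d as [|e]; [lia|]. rewrite mu_succ. unfold rho.
  pose proof (pos_INR e). destruct k as [|k].
  - simpl (mu 0 _). change (fact 1) with 1%nat. rewrite !S_INR. simpl (0 + e)%nat.
    simpl (INR 1). simpl (INR 0). field. split; [apply INR_fact_neq_0|lra].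
  - rewrite mu_succ. replace (k + S (S e))%nat with (S (S k + e)) by lia.
    rewrite !fact_simpl, !mult_INR, !S_INR, plus_INR, S_INR.
    pose proof (pos_INR k). field. repeat split; try apply INR_fact_neq_0; lra.
Qed.

Lemma rho_lift (d k : nat) : INR k + rho (S (S d)) = INR (S k) + rho d.
Proof. unfold rho. rewrite !S_INR. field. Qed.

Lemma Gamma_succ_half (d : nat) : (1 <= d)%nat ->
  Gamma (INR d / 2 + 1) = INR d / 2 * Gamma (INR d / 2).
Proof.
  intros Hd. destruct d as [|r]; [lia|]. rewrite S_INR. apply Gamma_succ.
Qed.

Lemma leading_coeff_lift (d : nat) : (1 <= d)%nat ->
  leading_coeff (S (S d)) = leading_coeff d / (2 * (INR d + 1)).
Proof.
  intros Hd. unfold leading_coeff.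
  replace (INR (S (S d)) / 2) with (INR d / 2 + 1) by (rewrite !S_INR; field).
  rewrite Gamma_succ_half by exact Hd. destruct d as [|e]; [lia|].
  replace (S (S (S e)) - 1)%nat with (S (S e)) by lia.
  replace (S e - 1)%nat with e by lia.
  rewrite !fact_simpl, !mult_INR, !S_INR. pose proof (pos_INR e).
  field. repeat split; try apply INR_fact_neq_0; lra.
Qed.

Lemma is_series_trace_lift (d i : nat) (t : R) :
  (1 <= d)%nat -> ex_series (trace_term d i t) -> ex_series (trace_term d (S i) t) ->
  is_series (trace_term (S (S d)) i t)
    (/ (INR d * (INR d + 1)) *
      (Series (trace_term d (S i) t) - rho d ^ 2 * Series (trace_term d i t))).
Proof.
  intros Hd H1 H2.
  set (a := fun k => / (INR d * (INR d + 1)) *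
    (trace_term d (S i) t k - rho d ^ 2 * trace_term d i t k)).
  assert (Ea : forall k, a k = / (INR d * (INR d + 1)) * (mu k d *
    ((INR k + rho d) ^ 2 - rho d ^ 2)) * (INR k + rho d) ^ (2 * i) *
    exp (- t * (INR k + rho d) ^ 2)).
  { intros k. unfold a, trace_term.
    replace (2 * S i)%nat with (2 + 2 * i)%nat by lia. rewrite pow_add. ring. }
  apply (is_series_ext (fun k => a (S k))).
  - intros k. rewrite Ea. unfold trace_term. rewrite rho_lift, mu_lift by exact Hd.
    unfold Rdiv. R_eq. ring.
  - apply (is_series_incr_1 a).
    (* The term k = 0 for d has no counterpart for d + 2, but x = rho there makes its new weight
       zero. *)
    assert (Ea0 : a 0%nat = 0) by (rewrite Ea; simpl; ring).
    rewrite Ea0. evar_last.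
    + apply (is_series_scal_l (/ (INR d * (INR d + 1)))
        (fun k => trace_term d (S i) t k - rho d ^ 2 * trace_term d i t k)).
      apply (is_series_minus (trace_term d (S i) t) (fun k => rho d ^ 2 * trace_term d i t k)).
      * apply Series_correct, H2.
      * apply (is_series_scal_l (rho d ^ 2) (trace_term d i t)), Series_correct, H1.
    + unfold scal, minus, plus, opp; simpl. unfold mult; simpl. R_eq. ring.
Qed.

(** In x^2 - rho^2 the first part raises i by one, while the second is left with a factor u^2 that
    shifts its coefficients; [moments_lift_diag] is the same combination. *)
Lemma trace_expansion_lift (d : nat) (p : nat -> R -> R) :
  (1 <= d)%nat -> moment_coeffs d p -> trace_expansion d p ->
  trace_expansion (S (S d)) (moments_lift d p).
Proof.
  intros Hd Hp HT i. destruct (HT i) as [H1 A1], (HT (S i)) as [H2 A2]. split.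
  - intros u Hu. eexists. apply is_series_trace_lift; auto.
  - assert (Hd0 : 0 < INR d) by (apply lt_0_INR; lia).
    eapply asymp_ext; [| |apply (asymp_linear _ _ _ _ (/ (INR d * (INR d + 1)))
      (- rho d ^ 2 / (INR d * (INR d + 1))) A2 (asymp_shift _ _ A1))].
    + intros u Hu. cbv beta.
      rewrite (is_series_unique _ _ (is_series_trace_lift d i (u ^ 2) Hd (H1 u Hu) (H2 u Hu))).
      replace (S (S d) + 2 * i)%nat with (2 + (d + 2 * i))%nat by lia.
      replace (d + 2 * S i)%nat with (2 + (d + 2 * i))%nat by lia.
      rewrite pow_add. field. lra.
    + intros n. cbv beta. rewrite moments_lift_diag, leading_coeff_lift by assumption.
      rewrite rise_head.
      replace (INR (S (S d)) / 2 - INR n) with (INR d / 2 - INR n + 1)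
        by (rewrite !S_INR; field).
      destruct n as [|n]; simpl prev; [field; lra|].
      replace (INR d / 2 - INR (S n) + 1) with (INR d / 2 - INR n)
        by (rewrite !S_INR; field).
      field; lra.
Qed.

Lemma ex_trace_expansion (d : nat) : (1 <= d)%nat ->
  exists p, moment_coeffs d p /\ trace_expansion d p.
Proof.
  intros Hd. destruct d as [|e]; [lia|]. clear Hd.
  induction e as [| |e [p [Hp HT]] _] using nat_ind2.
  - exists moments_circle. split; [apply moment_coeffs_circle|apply trace_expansion_circle].
  - exists moments_sphere. split; [apply moment_coeffs_sphere|apply trace_expansion_sphere].
  - exists (moments_lift (S e) p). split.
    + apply moment_coeffs_lift, Hp.
    + apply trace_expansion_lift; [lia|exact Hp|exact HT].
Qed.

(** * Products and uniqueness of expansions *)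

Lemma asymp_exp (kappa : R) : 0 <= kappa ->
  asymp (fun u => exp (kappa * u ^ 2)) (fun n => kappa ^ n / INR (fact n)).
Proof.
  intros Hk N. exists (kappa ^ S N * exp kappa). intros u Hu.
  assert (Hu2 : 0 < u ^ 2 <= 1) by nra.
  pose proof (taylor_bound N (fun m y => kappa ^ m * exp (kappa * y)) 0 1
    (kappa ^ S N * exp kappa)) as T. cbv beta in T.
  assert (HK : 0 <= kappa ^ S N) by (apply pow_le, Hk).
  specialize (T ltac:(intros m y; auto_derive; [auto|R_eq; simpl; ring])).
  assert (HM : forall y, Rabs (y - 0) <= 1 ->
    Rabs (kappa ^ S N * exp (kappa * y)) <= kappa ^ S N * exp kappa).
  { intros y Hy. rewrite Rabs_pos_eq by (apply Rmult_le_pos; [exact HK|left; apply exp_pos]).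
    apply Rmult_le_compat_l; [exact HK|]. rewrite Rminus_0_r in Hy.
    apply Rabs_le_between in Hy.
    destruct (Rle_lt_or_eq_dec (kappa * y) kappa) as [Hl|Hl]; [nra| |].
    - left; apply exp_increasing, Hl.
    - rewrite Hl; lra. }
  specialize (T HM (u ^ 2)). rewrite Rabs_pos_eq in T by lra. specialize (T (proj2 Hu2)).
  rewrite Rplus_0_l, pow_O, Rmult_1_l in T.
  eapply Rle_trans; [|eapply Rle_trans; [exact T|]].
  - right. f_equal. f_equal. apply sum_eq; intros i _.
    rewrite Rmult_0_r, exp_0, pow_mult. unfold Rdiv; ring.
  - apply Rmult_le_compat_l; [apply Rmult_le_pos; [exact HK|left; apply exp_pos]|].
    rewrite <- pow_mult. replace (2 * S N)%nat with (2 + 2 * N)%nat by lia.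
    rewrite pow_add. assert (0 <= u ^ (2 * N)) by (apply pow_le; lra). nra.
Qed.

(** The error is (E - E_N) F plus the sum of e_i u^(2i) (F - F_(N-i)), subscripts denoting
    truncation; each part is of order u^(2N). *)
Lemma asymp_mult (E F : R -> R) (e c : nat -> R) :
  asymp E e -> asymp F c ->
  asymp (fun u => E u * F u) (fun n => sum_f_R0 (fun i => e i * c (n - i)%nat) n).
Proof.
  intros HE HF N. destruct (HE N) as [DE HDE], (HF 0%nat) as [B HB].
  destruct (choose_bound _ N (fun m _ => HF (N - m)%nat)) as [D HD].
  exists (DE * (Rabs (c 0%nat) + B) + sum_f_R0 (fun i => Rabs (e i) * D i) N).
  intros u Hu. specialize (HDE u Hu). specialize (HB u Hu).
  assert (ES : sum_f_R0 (fun n => sum_f_R0 (fun i => e i * c (n - i)%nat) n * u ^ (2 * n)) N =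
    sum_f_R0 (fun i => e i * u ^ (2 * i) *
      sum_f_R0 (fun m => c m * u ^ (2 * m)) (N - i)) N).
  { transitivity (sum_f_R0 (fun i => sum_f_R0 (fun m =>
      e i * u ^ (2 * i) * (c m * u ^ (2 * m))) (N - i)) N).
    - rewrite <- (sum_triangle (fun i m => e i * u ^ (2 * i) * (c m * u ^ (2 * m)))).
      apply sum_eq; intros n Hn. rewrite sum_mult_r. apply sum_eq; intros i Hi.
      replace (2 * n)%nat with (2 * i + 2 * (n - i))%nat by lia. rewrite pow_add. ring.
    - apply sum_eq; intros i Hi. symmetry. apply sum_mult_l. }
  rewrite ES.
  match goal with |- Rabs ?A <= _ => replace A with
    ((E u - sum_f_R0 (fun n => e n * u ^ (2 * n)) N) * F u +
     sum_f_R0 (fun i => e i * u ^ (2 * i) *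
      (F u - sum_f_R0 (fun m => c m * u ^ (2 * m)) (N - i))) N) end.
  - eapply Rle_trans; [apply Rabs_triang|]. rewrite (Rmult_plus_distr_r _ _ (u ^ (2 * N))).
    assert (HuN : 0 <= u ^ (2 * N)) by (apply pow_le; lra).
    apply Rplus_le_compat.
    + rewrite Rabs_mult.
      assert (HFb : Rabs (F u) <= Rabs (c 0%nat) + B).
      { simpl in HB. replace (F u) with (c 0%nat + (F u - c 0%nat * 1)) by ring.
        eapply Rle_trans; [apply Rabs_triang|]. lra. }
      replace (DE * (Rabs (c 0%nat) + B) * u ^ (2 * N)) with
        (DE * u ^ (2 * N) * (Rabs (c 0%nat) + B)) by ring.
      apply Rmult_le_compat; try apply Rabs_pos; assumption.
    + rewrite sum_mult_r. apply sum_abs_le. intros i Hi. specialize (HD i Hi u Hu).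
      rewrite !Rabs_mult, (Rabs_pos_eq (u ^ (2 * i))) by (apply pow_le; lra).
      replace (2 * N)%nat with (2 * i + 2 * (N - i))%nat by lia. rewrite pow_add.
      replace (Rabs (e i) * D i * (u ^ (2 * i) * u ^ (2 * (N - i)))) with
        (Rabs (e i) * u ^ (2 * i) * (D i * u ^ (2 * (N - i)))) by ring.
      apply Rmult_le_compat_l; [|exact HD].
      apply Rmult_le_pos; [apply Rabs_pos|apply pow_le; lra].
  - rewrite (Rmult_minus_distr_r (E u)), sum_mult_r.
    match goal with |- ?X - ?Y + ?Z = ?X - ?W => cut (Z = Y - W); [intros ->; ring|] end.
    rewrite sum_sub. apply sum_eq; intros; ring.
Qed.

(** By strong induction the truncations at n differ by (a_n - c_n) u^(2n) only; [asymp] is used at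
    order n + 1, where its error is small against u^(2n). *)
Lemma asymp_unique (F : R -> R) (a c : nat -> R) :
  asymp F c ->
  (forall N eps, 0 < eps -> exists delta, 0 < delta /\ forall u, 0 < u < delta ->
    Rabs (F u - sum_f_R0 (fun n => a n * u ^ (2 * n)) N) <= eps * u ^ (2 * N)) ->
  forall n, a n = c n.
Proof.
  intros Hc Ha n. induction n as [n IH] using (well_founded_induction Wf_nat.lt_wf).
  assert (HE : forall eps, 0 < eps -> Rabs (a n - c n) <= 2 * eps).
  { intros eps Heps. destruct (Ha n eps Heps) as (delta & Hdel & H1).
    destruct (Hc (S n)) as [D HD].
    set (D' := Rabs D + Rabs (c (S n)) + 1).
    assert (HD' : 0 < D').
    { unfold D'. pose proof (Rabs_pos D). pose proof (Rabs_pos (c (S n))). lra. }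
    (* Below delta and 1, and so small that D' u <= eps absorbs the term of order n + 1 with its
       error. *)
    set (u := Rmin (Rmin (delta / 2) 1) (eps / D')).
    assert (He : 0 < eps / D') by (apply Rdiv_lt_0_compat; lra).
    assert (Hu0 : 0 < u) by (unfold u; repeat apply Rmin_glb_lt; lra).
    assert (Hu1 : u <= delta / 2) by (unfold u; eapply Rle_trans; [apply Rmin_l|apply Rmin_l]).
    assert (Hu2 : u <= 1) by (unfold u; eapply Rle_trans; [apply Rmin_l|apply Rmin_r]).
    assert (Hu3 : D' * u <= eps).
    { apply Rle_trans with (D' * (eps / D')).
      - apply Rmult_le_compat_l; [lra|apply Rmin_r].
      - right; field; lra. }
    specialize (H1 u ltac:(lra)). specialize (HD u ltac:(lra)).
    assert (Hp : 0 < u ^ (2 * n)) by (apply pow_lt, Hu0).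
    rewrite tech5 in HD.
    replace (2 * S n)%nat with (2 + 2 * n)%nat in HD by lia. rewrite pow_add in HD.
    assert (Ed : sum_f_R0 (fun n => a n * u ^ (2 * n)) n -
      sum_f_R0 (fun n => c n * u ^ (2 * n)) n = (a n - c n) * u ^ (2 * n)).
    { destruct n as [|n]; [simpl; ring|]. rewrite !tech5.
      rewrite (sum_eq (fun n => a n * u ^ (2 * n)) (fun n => c n * u ^ (2 * n)) n).
      - ring.
      - intros i Hi. rewrite IH by lia. reflexivity. }
    apply (Rmult_le_reg_r (u ^ (2 * n))); [exact Hp|].
    rewrite <- (Rabs_pos_eq (u ^ (2 * n))) at 1 by lra. rewrite <- Rabs_mult, <- Ed.
    set (S1 := sum_f_R0 (fun n => a n * u ^ (2 * n)) n) in *.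
    set (S2 := sum_f_R0 (fun n => c n * u ^ (2 * n)) n) in *.
    replace (S1 - S2) with ((F u - (S2 + c (S n) * (u ^ 2 * u ^ (2 * n)))) +
      (c (S n) * (u ^ 2 * u ^ (2 * n)) + - (F u - S1))) by ring.
    eapply Rle_trans; [apply Rabs_triang|].
    eapply Rle_trans; [apply Rplus_le_compat_l, Rabs_triang|].
    rewrite Rabs_Ropp, !Rabs_mult, (Rabs_pos_eq (u ^ 2)), (Rabs_pos_eq (u ^ (2 * n))) by nra.
    assert (Hk : (D + Rabs (c (S n))) * u ^ 2 <= eps).
    { apply Rle_trans with (D' * u); [|exact Hu3].
      pose proof (Rle_abs D). pose proof (Rabs_pos (c (S n))).
      apply Rle_trans with (D' * u ^ 2).
      - apply Rmult_le_compat_r; [nra|unfold D'; lra].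
      - apply Rmult_le_compat_l; [lra|nra]. }
    apply Rle_trans with ((D + Rabs (c (S n))) * u ^ 2 * u ^ (2 * n) + eps * u ^ (2 * n)).
    - lra.
    - nra. }
  destruct (Req_dec (a n) (c n)) as [E|E]; [exact E|exfalso].
  assert (0 < Rabs (a n - c n)) by (apply Rabs_pos_lt; lra).
  specialize (HE (Rabs (a n - c n) / 3) ltac:(lra)). lra.
Qed.

Lemma heat_trace_eq (d : nat) (t : R) :
  heat_trace d t = exp (rho d ^ 2 * t) * Series (trace_term d 0 t).
Proof.
  unfold heat_trace. rewrite <- Series_scal_l. apply Series_ext. intros k.
  unfold trace_term.
  replace (- t * lambda k d) with (rho d ^ 2 * t + - t * (INR k + rho d) ^ 2)
    by (unfold lambda, rho; field).
  rewrite exp_plus. simpl. ring.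
Qed.

Lemma Rpower_square (d n : nat) (u : R) : 0 < u ->
  u ^ d * Rpower (u ^ 2) (INR n - INR d / 2) = u ^ (2 * n).
Proof.
  intros Hu. rewrite <- !(Rpower_pow _ u) by exact Hu.
  rewrite Rpower_mult, <- Rpower_plus, mult_INR. f_equal. simpl (INR 2). field.
Qed.

(** After t = u^2 and multiplication by u^d both expansions are in even powers of u, and uniqueness
    applies. *)
Lemma heat_invariants_eq (d : nat) (p : nat -> R -> R) (a : nat -> R) :
  trace_expansion d p -> heat_invariants d a ->
  forall n, a n = leading_coeff d * moments d p n (- (INR d / 2)).
Proof.
  intros HT Ha. destruct (HT 0%nat) as [_ HA].
  assert (HF : asymp (fun u => u ^ d * heat_trace d (u ^ 2))
    (fun n => leading_coeff d * moments d p n (- (INR d / 2)))).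
  { eapply asymp_ext; [| |apply (asymp_mult _ _ _ _ (asymp_exp (rho d ^ 2) (pow2_ge_0 _)) HA)].
    - intros u Hu. cbv beta. rewrite heat_trace_eq, Nat.mul_0_r, Nat.add_0_r. ring.
    - intros n. unfold moments, exp_conv. rewrite sum_mult_l. apply sum_eq; intros; simpl; ring. }
  apply (asymp_unique _ _ _ HF). intros N eps Heps.
  destruct (Ha N (mkposreal eps Heps)) as [delta Hd].
  exists (Rmin delta 1). split; [apply Rmin_glb_lt; [apply cond_pos|lra]|].
  intros u Hu. pose proof (Rmin_l delta 1). pose proof (Rmin_r delta 1).
  assert (Hu2 : 0 < u ^ 2 < delta) by nra.
  specialize (Hd (u ^ 2)). unfold norm in Hd; simpl norm in Hd. unfold abs in Hd; simpl abs in Hd.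
  assert (Hb : ball 0 delta (u ^ 2)).
  { unfold ball; simpl. unfold AbsRing_ball, abs, minus, plus, opp; simpl.
    rewrite Ropp_0, Rplus_0_r, Rabs_pos_eq; simpl in Hu2; lra. }
  specialize (Hd Hb (proj1 Hu2)). rewrite sum_n_Reals in Hd.
  assert (Hud : 0 < u ^ d) by (apply pow_lt; lra).
  match goal with |- Rabs ?A <= _ => replace A with (u ^ d * (heat_trace d (u ^ 2) -
    sum_f_R0 (fun n => a n * Rpower (u ^ 2) (INR n - INR d / 2)) N)) end.
  - rewrite Rabs_mult, Rabs_pos_eq by lra.
    rewrite <- (Rpower_square d N u) by lra.
    rewrite (Rabs_pos_eq (Rpower _ _)) in Hd by (left; apply exp_pos).
    apply (Rmult_le_compat_l (u ^ d)) in Hd; [|lra].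
    eapply Rle_trans; [exact Hd|right; simpl; ring].
  - rewrite Rmult_minus_distr_l, sum_mult_l. f_equal. apply sum_eq; intros i _.
    rewrite <- (Rpower_square d i u) by lra. ring.
Qed.

(** * The formula for the heat invariants *)

Lemma Gamma_rise (d N : nat) : (1 <= d)%nat ->
  Gamma (INR N + INR d / 2) = rise (INR d / 2) N * Gamma (INR d / 2).
Proof.
  intros Hd. induction N as [|N IH].
  - simpl. rewrite Rplus_0_l. ring.
  - replace (INR (S N) + INR d / 2) with (INR (d + 2 * N) / 2 + 1)
      by (rewrite S_INR, plus_INR, mult_INR; simpl; field).
    rewrite Gamma_succ_half by lia.
    replace (INR (d + 2 * N) / 2) with (INR N + INR d / 2)
      by (rewrite plus_INR, mult_INR; simpl; field).
    rewrite IH. simpl rise. ring.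
Qed.

Theorem theorem1p1 (d : nat) (hd : (1 <= d)%nat)
    (a : nat -> R) (ha : heat_invariants d a)
    (n : nat) (hn : (1 <= n)%nat)
    (omega : nat) (homega : (2 * n <= omega)%nat) :
  a n =
  sum_n_m (fun j : nat =>
    2 * (-1) ^ n * Gamma (INR omega + INR d / 2 + 1) /
      (INR (fact (omega - j)) * INR (fact (j + n)) * INR (fact (2 * j + d))) *
    sum_n_m (fun k : nat =>
      (-1) ^ k * Binomial.C (2 * j + d - 1) (j - k) *
        mu k d * lambda k d ^ (j + n)) 1 j) 1 omega.
Proof.
  destruct (ex_trace_expansion d hd) as (p & Hp & HT).
  rewrite (heat_invariants_eq d p a HT ha n).
  assert (Hd0 : 0 < INR d) by (apply lt_0_INR; lia).
  set (P := moments d p n).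
  assert (Hrise : rise (INR d / 2) (S omega) <> 0).
  { apply rise_neq_0. intros j _. pose proof (pos_INR j). lra. }
  (* The added term k = 0 is zero because lambda_0 = 0 and j + n >= 1. *)
  assert (Einner : forall j, sum_n_m (fun k => (-1) ^ k * Binomial.C (2 * j + d - 1) (j - k) *
    mu k d * lambda k d ^ (j + n)) 1 j = spectral_sum d j (j + n)).
  { intros j. unfold spectral_sum. rewrite <- sum_n_Reals.
    unfold sum_n. rewrite (sum_Sn_m _ 0 j) by lia.
    replace (lambda 0 d) with 0 by (unfold lambda; simpl; ring).
    rewrite pow_i by lia. rewrite Rmult_0_r. symmetry; apply (@plus_zero_l R_AbelianMonoid). }
  replace (INR omega + INR d / 2 + 1) with (INR (S omega) + INR d / 2)
    by (rewrite S_INR; ring).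
  rewrite Gamma_rise by exact hd.
  (* The degree is at most 2n, so omega >= 2n provides enough nodes. *)
  assert (HP : poly (S omega) P).
  { apply (poly_weaken (S (2 * n))); [lia|apply poly_moments, Hp]. }
  pose proof (poly_extrapolation omega P (INR d / 2) HP) as E.
  specialize (E ltac:(intros j _; pose proof (pos_INR j); lra)).
  transitivity (sum_f_R0 (fun j => rise (INR d / 2) (S omega) * leading_coeff d / INR (fact omega) *
    ((-1) ^ j * Binomial.C omega j * / (INR d / 2 + INR j) * P (INR j))) omega).
  - rewrite <- sum_mult_l, E. field. split; [exact Hrise|apply INR_fact_neq_0].
  - rewrite <- sum_n_Reals. unfold sum_n. rewrite (sum_Sn_m _ 0 omega) by lia.
    (* Dropping the node j = 0 is where n >= 1 enters. *)
    replace (P (INR 0)) with 0.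
    2: { destruct n as [|m]; [lia|]. symmetry. apply moments_at_0, Hp. }
    rewrite !Rmult_0_r. etransitivity; [apply (@plus_zero_l R_AbelianMonoid)|].
    apply sum_n_m_ext_loc. intros j Hj.
    rewrite Einner, (spectral_sum_moments d p hd Hp). fold P.
    unfold leading_coeff, Binomial.C.
    replace (2 * j + d)%nat with (S (2 * j + d - 1)) by lia.
    rewrite (fact_simpl (2 * j + d - 1)), mult_INR.
    (* The factor 2j + d = 2 (d/2 + j) accounts for the denominator of the extrapolation formula and
       for the 2 in the statement. *)
    replace (INR (S (2 * j + d - 1))) with (2 * INR j + INR d).
    2: { replace (S (2 * j + d - 1)) with (2 * j + d)%nat by lia.
         rewrite plus_INR, mult_INR. reflexivity. }
    replace (S (2 * j + d - 1) - 1)%nat with (2 * j + d - 1)%nat by lia.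
    rewrite pow_add.
    assert (Hsq : (-1) ^ n * (-1) ^ n = 1).
    { rewrite <- Rpow_mult_distr. replace (-1 * -1) with 1 by ring. apply pow1. }
    pose proof (pos_INR j). R_eq.
    (* The signs (-1)^n and (-1)^(j + n) must combine to (-1)^j; inserting the square of (-1)^n lets
       [field] see it. *)
    match goal with |- ?L = ?R => transitivity (((-1) ^ n * (-1) ^ n) * L) end.
    + rewrite Hsq; ring.
    + field. repeat split; try apply INR_fact_neq_0; lra.
Qed.
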